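(* Let $X$ be an algebraic variety over $k$ with field of rational functions $K_X$. The assignments $$\partial\longmapsto \phi_\partial,\qquad \varphi\longmapsto D_\varphi$$ are well defined and mutually inverse, giving a one-to-one correspondence between the set of rational semisimple derivations $\partial\colon K_X\to K_X$ and the set of rational $\mathbb{G}_{\mathrm{m}}$-actions $\varphi\colon \mathbb{G}_{\mathrm{m}}\times X\dashrightarrow X$ on $X$.
   Context: Let $k$ be an algebraically closed field of characteristic zero. A variety is an integral separated scheme of finite type over $k$; $K_X$ is the field of rational functions of $X$. All derivations are $k$-derivations. $\mathbb{G}_{\mathrm{m}}$ is the multiplicative group over $k$, with coordinate $t$, group law $\mu$ and neutral element $e\colon \operatorname{Spec}(k)\to\mathbb{G}_{\mathrm{m}}$. Rational action: a rational $\mathbb{G}_{\mathrm{m}}$-action on $X$ is a rational map $\varphi\colon \mathbb{G}_{\mathrm{m}}\times X\dashrightarrow X$ such that, as rational maps, $\varphi\circ(\mathrm{id}_{\mathbb{G}_{\mathrm{m}}}\times\varphi)=\varphi\circ(\mu\times \mathrm{id}_X)$ on $\mathbb{G}_{\mathrm{m}}\times\mathbb{G}_{\mathrm{m}}\times X$ and $\varphi\circ(e\times \mathrm{id}_X)=\mathrm{pr}_2$ on $\operatorname{Spec}(k)\times X$. Its comorphism is the field homomorphism $\varphi^*\colon K_X\to k(\mathbb{G}_{\mathrm{m}}\times X)=K_X(t)$; its image lies in $\{r\in K_X(t)\mid \operatorname{ord}_1(r)\ge 0\}=K_X(t)\cap K_X[[t-1]]$, where $\operatorname{ord}_1$ is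 the order of vanishing at $t=1$. Rational semisimple: a derivation $\partial\colon K_X\to K_X$ is rational semisimple if there is a generating set $\{a_i\}_{i\in I}$ of $K_X$ (as a field) such that $\partial(a_i)=\lambda_i a_i$ with $\lambda_i\in\mathbb{Z}$ for all $i\in I$. From derivations to actions: let $\exp(z\partial)\colon K_X\to K_X[[z]]$, $f\mapsto\sum_{i\ge0}\frac{z^i\partial^i(f)}{i!}$, and let $\sigma\colon K_X[[z]]\to K_X[[t-1]]$ be the isomorphism of power series rings over $K_X$ given by $z\mapsto\sum_{i\ge1}(-1)^{i+1}\frac{(t-1)^i}{i}$. Put $\phi_\partial^*=\sigma\circ\exp(z\partial)\colon K_X\to K_X[[t-1]]$. When the image of $\phi^*_\partial$ is contained in $K_X(t)$, $\phi_\partial\colon \mathbb{G}_{\mathrm{m}}\times X\dashrightarrow X$ denotes the rational map with comorphism $\phi_\partial^*$. From actions to derivations: $D_\varphi\colon K_X\to K_X$, $f\mapsto \operatorname{ev}_1\circ\frac{d}{dt}\circ\varphi^*(f)$, where $\operatorname{ev}_1$ is evaluation at $t=1$. *)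

(* Defs.v *)
From HB Require Import structures.
From mathcomp Require Import mpoly.
From mathcomp Require Import all_boot all_order all_algebra.
From mathcomp Require Import mathcomp_extra boolp classical_sets functions.
From mathcomp Require Import topology_structure.
Set Implicit Arguments.
Unset Strict Implicit.
Unset Printing Implicit Defensive.
Import GRing.Theory.
Local Open Scope classical_set_scope.
Local Open Scope ring_scope.
Local Open Scope quotient_scope.

(* Varieties over an algebraically closed field are rendered as spaces with
   functions: a topological space with, for each open set, an algebra of
   k-valued "regular" functions.  Functions are total in type theory, so
   [reg U f] only constrains the values of [f] on [U] (see [reg_local]). *)
Record fspace (k : fieldType) := FSpace {
  fcar :> topologicalType;
  reg : set fcar -> (fcar -> k) -> Prop;
  reg_sub : forall (U V : set fcar) f,
    open V -> V `<=` U -> reg U f -> reg V f;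
  reg_local : forall (U : set fcar) (f : fcar -> k), open U ->
    (forall x, U x -> exists V g,
       [/\ open V, V x, V `<=` U, reg V g & forall y, V y -> f y = g y]) ->
    reg U f;
  reg_cst : forall (U : set fcar) (c : k), open U -> reg U (fun=> c);
  reg_add : forall (U : set fcar) f g, open U ->
    reg U f -> reg U g -> reg U (fun x => f x + g x);
  reg_mul : forall (U : set fcar) f g, open U ->
    reg U f -> reg U g -> reg U (fun x => f x * g x);
  reg_inv : forall (U : set fcar) f, open U -> reg U f ->
    open (U `&` [set x | f x != 0]) /\
    reg (U `&` [set x | f x != 0]) (fun x => (f x)^-1)
}.
Arguments reg {k X} U f : rename.

(* The space with functions on a set T generated by a family B of partially
   defined functions (B D f: f is a generator with domain D): the open sets are
   the unions of the {x in D | f x != 0}, and the regular functions are locally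
   quotients of generators. *)
Record fbasis (k : fieldType) (T : Type) := FBasis {
  bas :> set T -> (T -> k) -> Prop;
  bas_cst : forall c, bas setT (fun=> c);
  bas_add : forall D E f g,
    bas D f -> bas E g -> bas (D `&` E) (fun x => f x + g x);
  bas_mul : forall D E f g,
    bas D f -> bas E g -> bas (D `&` E) (fun x => f x * g x)
}.

Definition btype (k : fieldType) (T : Type) (B : fbasis k T) : Type := T.

Section Generated.
Variables (k : fieldType) (T : Type) (B : fbasis k T).

Definition bopen : set_system T := [set W | forall x, W x ->
  exists D f, [/\ B D f, D x, f x != 0 &
    forall y, D y -> f y != 0 -> W y]].

Lemma bopenT : bopen setT.
Proof.
by move=> x _; exists setT, (fun=> 1); split=> //; [exact: bas_cst|exact: oner_neq0].
Qed.

Lemma bopenI : setI_closed bopen.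
Proof.
move=> U V oU oV x [/oU[D [f [BD Dx fx DU]]] /oV[E [g [BE Ex gx EV]]]].
exists (D `&` E), (fun x => f x * g x); split=> //.
- exact: bas_mul.
- by rewrite mulf_neq0.
- by move=> y [Dy Ey]; rewrite mulf_eq0 negb_or => /andP[? ?]; split; auto.
Qed.

Lemma bopen_bigU (I : Type) (F : I -> set T) :
  (forall i, bopen (F i)) -> bopen (\bigcup_i F i).
Proof.
move=> oF x [i _ /oF[D [f [BD Dx fx DF]]]].
by exists D, f; split=> // y Dy fy; exists i => //; exact: DF.
Qed.

HB.instance Definition _ := gen_eqMixin (btype B).
HB.instance Definition _ := gen_choiceMixin (btype B).
HB.instance Definition _ :=
  isOpenTopological.Build (btype B) bopenT bopenI bopen_bigU.

Lemma openbE (W : set (btype B)) : open W = bopen W. Proof. by []. Qed.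

Definition breg (W : set (btype B)) (f : btype B -> k) : Prop :=
  forall x, W x -> exists V D E g h,
    [/\ open V, V x, V `<=` W, B D g /\ B E h &
        forall y, V y -> [/\ D y, E y, h y != 0 & f y = g y / h y]].

Lemma breg_sub (U V : set (btype B)) f :
  open V -> V `<=` U -> breg U f -> breg V f.
Proof.
move=> oV VU rf x Vx; have [W [D [E [g [h [oW Wx WU BB H]]]]]] := rf x (VU x Vx).
exists (W `&` V), D, E, g, h; split=> //; first exact: openI.
by move=> y [/H].
Qed.

Lemma breg_local (U : set (btype B)) (f : btype B -> k) : open U ->
  (forall x, U x -> exists V g,
     [/\ open V, V x, V `<=` U, breg V g & forall y, V y -> f y = g y]) ->
  breg U f.
Proof.
move=> oU H x /H[V [f' [oV Vx VU rf' ff']]].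
have [W [D [E [g [h [oW Wx WV BB H']]]]]] := rf' x Vx.
exists W, D, E, g, h; split=> //; first by move=> y /WV/VU.
by move=> y Wy; rewrite ff'; [exact: H'|exact: WV].
Qed.

Lemma breg_cst (U : set (btype B)) (c : k) : open U -> breg U (fun=> c).
Proof.
move=> oU x Ux; exists U, setT, setT, (fun=> c), (fun=> 1); split=> //.
  by split; exact: bas_cst.
by move=> y _; split=> //; [exact: oner_neq0|rewrite divr1].
Qed.

Lemma breg_add (U : set (btype B)) f g : open U ->
  breg U f -> breg U g -> breg U (fun x => f x + g x).
Proof.
move=> oU rf rg x Ux.
have [V [D [E [a [b [oV Vx VU [Ba Bb] H]]]]]] := rf x Ux.
have [V' [D' [E' [a' [b' [oV' Vx' VU' [Ba' Bb'] H']]]]]] := rg x Ux.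
exists (V `&` V'), ((D `&` E') `&` (D' `&` E)), (E `&` E'),
  (fun x => a x * b' x + a' x * b x), (fun x => b x * b' x); split=> //.
- exact: openI.
- by move=> y [/VU].
- by split; [apply: bas_add|]; exact: bas_mul.
- move=> y [/H[? ? b0 ->] /H'[? ? b'0 ->]]; split=> //.
    by rewrite mulf_neq0.
  by rewrite addf_div.
Qed.

Lemma breg_mul (U : set (btype B)) f g : open U ->
  breg U f -> breg U g -> breg U (fun x => f x * g x).
Proof.
move=> oU rf rg x Ux.
have [V [D [E [a [b [oV Vx VU [Ba Bb] H]]]]]] := rf x Ux.
have [V' [D' [E' [a' [b' [oV' Vx' VU' [Ba' Bb'] H']]]]]] := rg x Ux.
exists (V `&` V'), (D `&` D'), (E `&` E'),
  (fun x => a x * a' x), (fun x => b x * b' x); split=> //.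
- exact: openI.
- by move=> y [/VU].
- by split; exact: bas_mul.
- move=> y [/H[? ? b0 ->] /H'[? ? b'0 ->]]; split=> //.
    by rewrite mulf_neq0.
  by rewrite mulf_div.
Qed.

Lemma breg_inv (U : set (btype B)) f : open U -> breg U f ->
  open (U `&` [set x | f x != 0]) /\
  breg (U `&` [set x | f x != 0]) (fun x => (f x)^-1).
Proof.
move=> oU rf.
have oU' : open (U `&` [set x | f x != 0]).
  rewrite openbE => x [Ux fx].
  have [V [D [E [a [b [oV Vx VU [Ba Bb] H]]]]]] := rf x Ux.
  have ax : a x != 0.
    by apply: contraNneq fx => a0; have [_ _ _ ->] := H x Vx; rewrite a0 mul0r.
  have [Dx Ex bx fxE] := H x Vx.
  move: oV; rewrite openbE => /(_ x Vx)[D' [g [Bg D'x gx D'V]]].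
  exists (D' `&` D), (fun x => g x * a x); split=> //.
  - exact: bas_mul.
  - by rewrite mulf_neq0.
  - move=> y [D'y Dy]; rewrite mulf_eq0 negb_or => /andP[gy ay].
    have Vy := D'V y D'y gy; have [_ _ b0 fE] := H y Vy.
    by split; [exact: VU|rewrite /= fE mulf_neq0 ?invr_eq0].
split=> // x [Ux fx].
have [V [D [E [a [b [oV Vx VU [Ba Bb] H]]]]]] := rf x Ux.
exists (V `&` (U `&` [set x | f x != 0])), E, D, b, a; split=> //.
- exact: openI.
- move=> y [Vy [_ fy]]; have [Dy Ey b0 fE] := H y Vy; split=> //.
    by apply: contraNneq fy => a0; rewrite fE a0 mul0r.
  by rewrite fE invf_div.
Qed.

Definition bspace : fspace k := FSpace breg_sub breg_local breg_cst
  breg_add breg_mul breg_inv.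

End Generated.

Section AlgebraicSet.
Variables (k : fieldType) (n : nat) (S : set {mpoly k[n]}).

Definition zeros : Type :=
  {v : 'I_n -> k | forall p, S p -> p.@[v] = 0}.

Definition poly_fun (D : set zeros) (f : zeros -> k) : Prop :=
  D = setT /\ exists p : {mpoly k[n]}, f = fun v => p.@[sval v].

Lemma poly_fun_cst c : poly_fun setT (fun=> c).
Proof.
split=> //; exists (c%:MP); apply/funext => v.
by rewrite mevalC.
Qed.

Lemma poly_fun_add D E f g : poly_fun D f -> poly_fun E g ->
  poly_fun (D `&` E) (fun x => f x + g x).
Proof.
move=> [-> [p ->]] [-> [q ->]]; split; first by rewrite setIT.
by exists (p + q); apply/funext => v; rewrite mevalD.
Qed.

Lemma poly_fun_mul D E f g : poly_fun D f -> poly_fun E g ->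
  poly_fun (D `&` E) (fun x => f x * g x).
Proof.
move=> [-> [p ->]] [-> [q ->]]; split; first by rewrite setIT.
by exists (p * q); apply/funext => v; rewrite mevalM.
Qed.

Definition affine_set : fspace k :=
  bspace (FBasis poly_fun_cst poly_fun_add poly_fun_mul).

End AlgebraicSet.

Section Gm.
Variable k : fieldType.

Definition gm : Type := {x : k | x != 0}.
Definition gm1 : gm := exist _ 1 (oner_neq0 k).
Definition gm_mul (s t : gm) : gm :=
  exist _ (sval s * sval t) (mulf_neq0 (svalP s) (svalP t)).

(* Polynomials in the coordinate t suffice: quotients are taken in [bspace]. *)
Definition gm_fun (D : set gm) (f : gm -> k) : Prop :=
  D = setT /\ exists p : {poly k}, f = fun t => p.[sval t].

Lemma gm_fun_cst c : gm_fun setT (fun=> c).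
Proof. by split=> //; exists c%:P; apply/funext => v; rewrite hornerC. Qed.

Lemma gm_fun_add D E f g : gm_fun D f -> gm_fun E g ->
  gm_fun (D `&` E) (fun x => f x + g x).
Proof.
move=> [-> [p ->]] [-> [q ->]]; split; first by rewrite setIT.
by exists (p + q); apply/funext => v; rewrite hornerD.
Qed.

Lemma gm_fun_mul D E f g : gm_fun D f -> gm_fun E g ->
  gm_fun (D `&` E) (fun x => f x * g x).
Proof.
move=> [-> [p ->]] [-> [q ->]]; split; first by rewrite setIT.
by exists (p * q); apply/funext => v; rewrite hornerM.
Qed.

Definition Gm : fspace k := bspace (FBasis gm_fun_cst gm_fun_add gm_fun_mul).

End Gm.

Section Product.
Variables (k : fieldType) (X Y : fspace k).

(* The image of O(U) (x) O(V) in the functions on U * V. *)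
Inductive tensor (U : set X) (V : set Y) : (X * Y -> k) -> Prop :=
| tensor_fst a : reg U a -> tensor U V (fun z => a z.1)
| tensor_snd b : reg V b -> tensor U V (fun z => b z.2)
| tensor_add f g : tensor U V f -> tensor U V g ->
    tensor U V (fun z => f z + g z)
| tensor_mul f g : tensor U V f -> tensor U V g ->
    tensor U V (fun z => f z * g z).

Definition prod_fun (D : set (X * Y)) (f : X * Y -> k) : Prop :=
  exists U V, [/\ open U, open V, D = U `*` V & tensor U V f].

Lemma tensor_sub (U U' : set X) (V V' : set Y) f : open U' -> open V' ->
  U' `<=` U -> V' `<=` V -> tensor U V f -> tensor U' V' f.
Proof.
move=> oU oV sU sV; elim=> [a ra|b rb|g h _ ? _ ?|g h _ ? _ ?].
- exact/tensor_fst/(reg_sub oU sU).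
- exact/tensor_snd/(reg_sub oV sV).
- exact: tensor_add.
- exact: tensor_mul.
Qed.

Lemma prod_fun_cst c : prod_fun setT (fun=> c).
Proof.
exists setT, setT; split; [exact: openT|exact: openT|by rewrite setXTT|].
by apply: (@tensor_fst _ _ (fun=> c)); apply: reg_cst; exact: openT.
Qed.

Lemma prod_fun_add D E f g : prod_fun D f -> prod_fun E g ->
  prod_fun (D `&` E) (fun x => f x + g x).
Proof.
move=> [U [V [oU oV -> tf]]] [U' [V' [oU' oV' -> tg]]].
exists (U `&` U'), (V `&` V'); split.
- exact: openI.
- exact: openI.
- by rewrite setXI.
- apply: tensor_add.
  + by apply: tensor_sub tf; [exact: openI|exact: openI|exact: subIsetl..].
  + by apply: tensor_sub tg; [exact: openI|exact: openI|exact: subIsetr..].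
Qed.

Lemma prod_fun_mul D E f g : prod_fun D f -> prod_fun E g ->
  prod_fun (D `&` E) (fun x => f x * g x).
Proof.
move=> [U [V [oU oV -> tf]]] [U' [V' [oU' oV' -> tg]]].
exists (U `&` U'), (V `&` V'); split.
- exact: openI.
- exact: openI.
- by rewrite setXI.
- apply: tensor_mul.
  + by apply: tensor_sub tf; [exact: openI|exact: openI|exact: subIsetl..].
  + by apply: tensor_sub tg; [exact: openI|exact: openI|exact: subIsetr..].
Qed.

Definition zprod : fspace k :=
  bspace (FBasis prod_fun_cst prod_fun_add prod_fun_mul).

End Product.

Definition morph_on (k : fieldType) (Y X : fspace k) (U : set Y)
    (f : Y -> X) : Prop :=
  forall V : set X, open V -> open (U `&` f @^-1` V) /\
    forall g, reg V g -> reg (U `&` f @^-1` V) (g \o f).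

Definition affine_open (k : fieldType) (X : fspace k) (U : set X) : Prop :=
  open U /\
  exists n (S : set {mpoly k[n]})
         (x : X -> affine_set S) (y : affine_set S -> X),
    [/\ morph_on U x, morph_on setT y, forall z, U (y z),
        forall u, U u -> y (x u) = u & forall z, x (y z) = z].

Record variety (k : fieldType) := Variety {
  vspace :> fspace k;
  variety_nonempty : exists x : vspace, True;
  variety_irreducible : forall U V : set vspace,
    open U -> open V -> U !=set0 -> V !=set0 -> U `&` V !=set0;
  variety_cover : exists m (U : 'I_m -> set vspace),
    (forall i, affine_open (U i)) /\ (forall x, exists i, U i x);
  variety_separated : closed [set z : zprod vspace vspace | z.1 = z.2]
}.

Lemma dense_setI (T : topologicalType) (U V : set T) :
  open U -> dense U -> dense V -> dense (U `&` V).
Proof.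
move=> oU dU dV O O0 oO; rewrite setIA; apply: dV.
- exact: dU.
- exact: openI.
Qed.

Lemma denseT (T : topologicalType) : dense [set: T].
Proof. by move=> O O0 _; rewrite setIT. Qed.

(* Rational maps Y --> X: classes of morphisms defined on dense open subsets,
   modulo agreement on a dense open subset. *)
Record pmap (k : fieldType) (Y X : fspace k) := PMap {
  pdom : set Y;
  pfun :> Y -> X;
  pdom_open : open pdom;
  pdom_dense : dense pdom;
  pfun_morph : morph_on pdom pfun
}.

Section RationalMaps.
Variables (k : fieldType) (Y X : fspace k).

HB.instance Definition _ := gen_eqMixin (pmap Y X).
HB.instance Definition _ := gen_choiceMixin (pmap Y X).

Definition pmap_agree (p q : pmap Y X) : Prop :=
  exists W : set Y, [/\ open W, dense W, W `<=` pdom p `&` pdom q &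
    forall y, W y -> p y = q y].

Definition pmap_eq (p q : pmap Y X) : bool := `[< pmap_agree p q >].

Lemma pmap_eq_refl : reflexive pmap_eq.
Proof.
move=> p; apply/asboolP; exists (pdom p).
by split=> //; [exact: pdom_open|exact: pdom_dense].
Qed.

Lemma pmap_eq_sym : symmetric pmap_eq.
Proof.
have H p q : pmap_eq p q -> pmap_eq q p.
  move=> /asboolP[W [oW dW sW H]]; apply/asboolP; exists W; split=> //.
    by rewrite setIC.
  by move=> y /H.
by move=> p q; apply/idP/idP; exact: H.
Qed.

Lemma pmap_eq_trans : transitive pmap_eq.
Proof.
move=> q p r /asboolP[W [oW dW sW H]] /asboolP[W' [oW' dW' sW' H']].
apply/asboolP; exists (W `&` W'); split.
- exact: openI.
- exact: dense_setI.
- by move=> y [/sW[? _] /sW'[_ ?]].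
- by move=> y [/H-> /H'].
Qed.

Canonical pmap_equiv := EquivRel pmap_eq pmap_eq_refl pmap_eq_sym pmap_eq_trans.

Definition ratmap := {eq_quot pmap_eq}.

HB.instance Definition _ : EqQuotient _ pmap_eq ratmap := EqQuotient.on ratmap.
HB.instance Definition _ := Choice.on ratmap.

End RationalMaps.

Record germ (k : fieldType) (X : fspace k) := Germ {
  gdom : set X;
  gfun :> X -> k;
  gdom_open : open gdom;
  gdom_dense : dense gdom;
  gfun_reg : reg gdom gfun
}.

Section FunctionField.
Variables (k : fieldType) (X : variety k).
Local Notation germ := (germ X).

HB.instance Definition _ := gen_eqMixin germ.
HB.instance Definition _ := gen_choiceMixin germ.

Definition germ_agree (f g : germ) : Prop :=
  exists W : set X, [/\ open W, dense W, W `<=` gdom f `&` gdom g &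
    forall x, W x -> f x = g x].

Definition germ_eq (f g : germ) : bool := `[< germ_agree f g >].

Lemma germ_eq_refl : reflexive germ_eq.
Proof.
move=> f; apply/asboolP; exists (gdom f).
by split=> //; [exact: gdom_open|exact: gdom_dense].
Qed.

Lemma germ_eq_sym : symmetric germ_eq.
Proof.
have H f g : germ_eq f g -> germ_eq g f.
  move=> /asboolP[W [oW dW sW H]]; apply/asboolP; exists W; split=> //.
    by rewrite setIC.
  by move=> y /H.
by move=> f g; apply/idP/idP; exact: H.
Qed.

Lemma germ_eq_trans : transitive germ_eq.
Proof.
move=> g f h /asboolP[W [oW dW sW H]] /asboolP[W' [oW' dW' sW' H']].
apply/asboolP; exists (W `&` W'); split.
- exact: openI.
- exact: dense_setI.
- by move=> y [/sW[? _] /sW'[_ ?]].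
- by move=> y [/H-> /H'].
Qed.

Canonical germ_equiv := EquivRel germ_eq germ_eq_refl germ_eq_sym germ_eq_trans.

Definition funfield := {eq_quot germ_eq}.

HB.instance Definition _ : EqQuotient _ germ_eq funfield :=
  EqQuotient.on funfield.
HB.instance Definition _ := Choice.on funfield.

Lemma open_dense (U : set X) : open U -> U !=set0 -> dense U.
Proof.
by move=> oU U0 O O0 oO; exact: (variety_irreducible oO oU O0 U0).
Qed.

Definition germ_cst (c : k) : germ :=
  Germ openT (@denseT X) (reg_cst c (@openT X)).

Fact germ_op_open (f g : germ) : open (gdom f `&` gdom g).
Proof. by apply: openI; exact: gdom_open. Qed.

Fact germ_op_dense (f g : germ) : dense (gdom f `&` gdom g).
Proof.
by apply: dense_setI; [exact: gdom_open|exact: gdom_dense..].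
Qed.

Fact germ_regl (f g : germ) : reg (gdom f `&` gdom g) f.
Proof.
apply: (@reg_sub _ _ (gdom f)); [exact: germ_op_open|exact: subIsetl|].
exact: gfun_reg.
Qed.

Fact germ_regr (f g : germ) : reg (gdom f `&` gdom g) g.
Proof.
apply: (@reg_sub _ _ (gdom g)); [exact: germ_op_open|exact: subIsetr|].
exact: gfun_reg.
Qed.

Definition germ_add (f g : germ) : germ :=
  Germ (@germ_op_open f g) (@germ_op_dense f g)
    (reg_add (@germ_op_open f g) (@germ_regl f g) (@germ_regr f g)).

Definition germ_mul (f g : germ) : germ :=
  Germ (@germ_op_open f g) (@germ_op_dense f g)
    (reg_mul (@germ_op_open f g) (@germ_regl f g) (@germ_regr f g)).

Definition germ_opp (f : germ) : germ := germ_mul (germ_cst (-1)) f.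

Definition gnz (f : germ) : set X := gdom f `&` [set x | f x != 0].

Fact gnz_open (f : germ) : open (gnz f).
Proof. by have [] := reg_inv (@gdom_open _ _ f) (@gfun_reg _ _ f). Qed.

Fact gnz_reg (f : germ) : reg (gnz f) (fun x => (f x)^-1).
Proof. by have [] := reg_inv (@gdom_open _ _ f) (@gfun_reg _ _ f). Qed.

Definition germ_inv (f : germ) : germ :=
  match pselect (gnz f !=set0) with
  | left H => Germ (gnz_open f) (open_dense (gnz_open f) H) (@gnz_reg f)
  | right _ => germ_cst 0
  end.

Local Notation cls := (\pi_funfield).

Lemma germP (f g : germ) : cls f = cls g <-> germ_agree f g.
Proof.
split=> [/eqmodP/asboolP//|H]; apply/eqmodP; exact/asboolP.
Qed.

Lemma germ_eqP (f g : germ) (W : set X) : open W -> dense W ->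
  (forall x, W x -> gdom f x -> gdom g x -> f x = g x) -> cls f = cls g.
Proof.
move=> oW dW H; apply/germP; exists (W `&` (gdom f `&` gdom g)); split.
- by apply: openI => //; exact: germ_op_open.
- by apply: dense_setI => //; exact: germ_op_dense.
- exact: subIsetr.
- by move=> x [? [? ?]]; exact: H.
Qed.

Lemma germ_eqT (f g : germ) : (forall x, f x = g x) -> cls f = cls g.
Proof.
by move=> H; apply: (@germ_eqP _ _ setT) => //; [exact: openT|exact: denseT].
Qed.

Definition ff_cst (c : k) : funfield := cls (germ_cst c).
Definition ff_add (a b : funfield) : funfield :=
  cls (germ_add (repr a) (repr b)).
Definition ff_mul (a b : funfield) : funfield :=
  cls (germ_mul (repr a) (repr b)).
Definition ff_opp (a : funfield) : funfield := cls (germ_opp (repr a)).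
Definition ff_inv (a : funfield) : funfield := cls (germ_inv (repr a)).

Lemma repr_agree (f : germ) : germ_agree (repr (cls f)) f.
Proof. by apply/germP; rewrite reprK. Qed.

Lemma ff_addE f g : ff_add (cls f) (cls g) = cls (germ_add f g).
Proof.
have [W [oW dW _ H]] := repr_agree f; have [W' [oW' dW' _ H']] := repr_agree g.
apply: (@germ_eqP _ _ (W `&` W')); [exact: openI|exact: dense_setI|].
by move=> x [/H fx /H' gx] _ _ /=; rewrite fx gx.
Qed.

Lemma ff_mulE f g : ff_mul (cls f) (cls g) = cls (germ_mul f g).
Proof.
have [W [oW dW _ H]] := repr_agree f; have [W' [oW' dW' _ H']] := repr_agree g.
apply: (@germ_eqP _ _ (W `&` W')); [exact: openI|exact: dense_setI|].
by move=> x [/H fx /H' gx] _ _ /=; rewrite fx gx.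
Qed.

Lemma ff_oppE f : ff_opp (cls f) = cls (germ_opp f).
Proof.
have [W [oW dW _ H]] := repr_agree f.
by apply: (@germ_eqP _ _ W) => // x /H fx _ _ /=; rewrite fx.
Qed.

Lemma funfieldW (P : funfield -> Prop) : (forall f, P (cls f)) -> forall a, P a.
Proof. by move=> H a; rewrite -[a]reprK. Qed.

Fact ff_addA : associative ff_add.
Proof.
elim/funfieldW=> f; elim/funfieldW=> g; elim/funfieldW=> h.
by rewrite !ff_addE; apply: germ_eqT => x /=; rewrite addrA.
Qed.

Fact ff_addC : commutative ff_add.
Proof.
elim/funfieldW=> f; elim/funfieldW=> g.
by rewrite !ff_addE; apply: germ_eqT => x /=; rewrite addrC.
Qed.

Fact ff_add0 : left_id (ff_cst 0) ff_add.
Proof.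
by elim/funfieldW=> f; rewrite ff_addE; apply: germ_eqT => x /=; rewrite add0r.
Qed.

Fact ff_addN : left_inverse (ff_cst 0) ff_opp ff_add.
Proof.
elim/funfieldW=> f; rewrite ff_oppE ff_addE; apply: germ_eqT => x /=.
by rewrite mulN1r addNr.
Qed.

Fact ff_mulA : associative ff_mul.
Proof.
elim/funfieldW=> f; elim/funfieldW=> g; elim/funfieldW=> h.
by rewrite !ff_mulE; apply: germ_eqT => x /=; rewrite mulrA.
Qed.

Fact ff_mulC : commutative ff_mul.
Proof.
elim/funfieldW=> f; elim/funfieldW=> g.
by rewrite !ff_mulE; apply: germ_eqT => x /=; rewrite mulrC.
Qed.

Fact ff_mul1 : left_id (ff_cst 1) ff_mul.
Proof.
by elim/funfieldW=> f; rewrite ff_mulE; apply: germ_eqT => x /=; rewrite mul1r.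
Qed.

Fact ff_mulDl : left_distributive ff_mul ff_add.
Proof.
elim/funfieldW=> f; elim/funfieldW=> g; elim/funfieldW=> h.
by rewrite !(ff_mulE, ff_addE); apply: germ_eqT => x /=; rewrite mulrDl.
Qed.

Fact ff_10 : ff_cst 1 != ff_cst 0.
Proof.
apply/eqP => /germP[W [oW dW _ H]].
have [x0 _] := variety_nonempty X.
have [x [_ /H /eqP]] := dW setT (ex_intro _ x0 I) openT.
by rewrite /= oner_eq0.
Qed.

Fact ff_mulV a : a != ff_cst 0 -> ff_mul (ff_inv a) a = ff_cst 1.
Proof.
move=> a0; rewrite -{2}[a]reprK /ff_inv ff_mulE /germ_inv.
case: pselect => [H|N0] /=.
  apply: (@germ_eqP _ _ (gnz (repr a))); first exact: gnz_open.
    by apply: open_dense => //; exact: gnz_open.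
  by move=> x [_ fx] _ _ /=; rewrite mulVf.
case/eqP: a0; rewrite -[a]reprK.
apply: (@germ_eqP _ _ setT); [exact: openT|exact: denseT|].
move=> x _ Dx _ /=; apply/eqP; apply: contrapT => /negP fx.
by apply: N0; exists x; split.
Qed.

Fact ff_inv0 : ff_inv (ff_cst 0) = ff_cst 0.
Proof.
rewrite /ff_inv /germ_inv; case: pselect => // H.
have [W [oW dW sW E]] := repr_agree (germ_cst 0).
have [x [[_ fx] Wx]] := dW _ H (gnz_open _).
by move: fx; rewrite /= E // eqxx.
Qed.

HB.instance Definition _ :=
  GRing.isZmodule.Build funfield ff_addA ff_addC ff_add0 ff_addN.
HB.instance Definition _ := GRing.Zmodule_isComNzRing.Build funfield
  ff_mulA ff_mulC ff_mul1 ff_mulDl ff_10.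
HB.instance Definition _ :=
  GRing.ComNzRing_isField.Build funfield ff_mulV ff_inv0.

End FunctionField.

Section Theory.
Variables (k : fieldType) (X : variety k).
Local Notation K := (funfield X).
Local Notation Kt := {fraction {poly K}}.
Local Notation GX := (zprod (Gm k) X).

Definition derivation (d : K -> K) : Prop :=
  [/\ forall a b, d (a + b) = d a + d b,
      forall a b, d (a * b) = d a * b + a * d b &
      forall c : k, d (ff_cst X c) = 0].

Definition field_generates (I : Type) (a : I -> K) : Prop :=
  forall F : {pred K}, divring_closed F -> (forall i, a i \in F) ->
  forall x, x \in F.

Definition rational_semisimple (d : K -> K) : Prop :=
  derivation d /\
  exists (I : Type) (a : I -> K) (l : I -> int),
    field_generates a /\ forall i, d (a i) = (l i)%:~R * a i.

(* Identification of K_X(t) with the rational functions on Gm * X: the value at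
   (t, x) of r in K_X(t), meaningful for (t, x) in a dense open subset. *)
Definition poly_at (p : {poly K}) (z : GX) : k :=
  \sum_(i < size p) gfun (repr p`_i) z.2 * sval z.1 ^+ i.

Definition frac_at (r : Kt) (z : GX) : k :=
  poly_at \n_(repr r) z / poly_at \d_(repr r) z.

(* c f is the composite of f with phi.  For a phi that is not dominant there is
   no such c: the domains of rational functions on X would have to meet the image
   of phi. *)
Definition is_comorphism (phi : ratmap GX X) (c : K -> Kt) : Prop :=
  forall p : pmap GX X, \pi_(ratmap GX X) p = phi ->
  forall g : germ X, exists W : set GX,
    [/\ open W, dense W, W `<=` pdom p, (forall z, W z -> gdom g (p z)) &
        forall z, W z -> g (p z) = frac_at (c (\pi_(funfield X) g)) z].

Definition comorphism (phi : ratmap GX X) : K -> Kt :=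
  xget (fun=> 0) [set c | is_comorphism phi c].

(* The two conditions say that the rational maps phi o (id * phi) and
   phi o (mu * id), resp. phi o (e * id) and pr_2, are defined and agree on a
   dense open subset; Spec k * X is identified with X. *)
Definition rational_action (phi : ratmap GX X) : Prop :=
  exists p : pmap GX X, [/\ \pi_(ratmap GX X) p = phi,
    exists W : set (zprod (Gm k) GX), [/\ open W, dense W &
      forall (s t : Gm k) (x : X), W (s, (t, x)) ->
        [/\ pdom p (t, x), pdom p (s, p (t, x)), pdom p (gm_mul s t, x) &
            p (s, p (t, x)) = p (gm_mul s t, x)]] &
    exists U : set X, [/\ open U, dense U &
      forall x, U x -> pdom p (gm1 k, x) /\ p (gm1 k, x) = x]].

Definition ord1_ge0 (r : Kt) : Prop :=
  exists p q : {poly K}, q.[1] != 0 /\ r = tofrac p / tofrac q.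

Definition ddt (r : Kt) : Kt :=
  let n := \n_(repr r) in let d := \d_(repr r) in
  tofrac (n^`() * d - n * d^`()) / tofrac (d ^+ 2).

Definition ev1 (r : Kt) : K :=
  xget 0 [set a | exists p q : {poly K},
    [/\ q.[1] != 0, r = tofrac p / tofrac q & a = p.[1] / q.[1]]].

Definition D_of (phi : ratmap GX X) (f : K) : K := ev1 (ddt (comorphism phi f)).

(* A power series is its sequence of coefficients, in powers of t - 1 for
   [log_series], [phi_star] and [is_expansion]. *)
Definition exp_series (d : K -> K) (f : K) (i : nat) : K :=
  iter i d f / i`!%:R.

Definition log_series (j : nat) : K :=
  if j == 0 then 0 else (-1) ^+ j.+1 / j%:R.

(* a(b(u)) for a series b without constant term; the coefficient of u^n only
   involves the terms of a and b of index at most n. *)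
Definition series_subst (a b : nat -> K) (n : nat) : K :=
  \sum_(i < n.+1) a i * ((\poly_(j < n.+1) b j) ^+ i)`_n.

Definition phi_star (d : K -> K) (f : K) : nat -> K :=
  series_subst (exp_series d f) log_series.

(* s is the image of r under the inclusion of {ord_1 >= 0} in K_X[[t - 1]]. *)
Definition is_expansion (r : Kt) (s : nat -> K) : Prop :=
  exists p q : {poly K}, [/\ q.[1] != 0, r = tofrac p / tofrac q &
    forall n, \sum_(i < n.+1) (q \Po ('X + 1))`_i * s (n - i)%N
              = (p \Po ('X + 1))`_n].

(* phi is the rational map with comorphism phi_star d. *)
Definition is_phi (d : K -> K) (phi : ratmap GX X) : Prop :=
  exists c, is_comorphism phi c /\ forall f, is_expansion (c f) (phi_star d f).

End Theory.

(* Main.v *)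
(** A family of semi-invariants mediates between the two sides.  Given a
    rational action with comorphism c, write c(f) = P / Q in K_X(t) with P and Q
    coprime and Q monic.  Computing f(s (t x)) = f((s t) x) in two ways gives two
    reduced fractions in K_X(t)(s), so that c(a) = t^(j - m) a for the
    coefficient a of t^j in P or in Q, where m = deg Q.  As f = P(1) / Q(1), the
    eigenvectors of d/dt at t = 1 with integral eigenvalues generate K_X.

    Conversely, if a derivation d is semisimple, then every f is P(1) / Q(1) where
    the coefficient of t^j in P and in Q has eigenvalue j - m.  The series
    phi_d^*(f) = sum_n binom(d, n)(f) (t - 1)^n is the solution of
    t g' = phi_d^*(d f) with g(1) = f, whence phi_d^*(f) = P / Q.  This defines a
    homomorphism c from K_X to K_X(t), and its values at the coordinates of an
    affine chart define the action.  Identities between rational functions are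
    checked at generic points; Gm * X is irreducible, and a regular function on
    it is locally a quotient of polynomials in t over K_X. *)
Require Import Defs.
From HB Require Import structures.
From mathcomp Require Import mpoly.
From mathcomp Require Import all_boot all_order all_algebra.
From mathcomp Require Import boolp classical_sets topology_structure.
From mathcomp Require Import ring.
Set Implicit Arguments.
Unset Strict Implicit.
Unset Printing Implicit Defensive.
Import GRing.Theory.
Local Open Scope ring_scope.

(** * Power series and the Euler operator *)

(** Rational functions have values at generic points only, whereas the unit axiom concerns the
    single value t = 1. Local formulas on Gm * X are therefore stated for generic x and every t in
    an open set, so that they can be specialised at t = 1. The unit axiom also yields dominance: the
    preimage of a dense open set contains some (1, x), hence is dense, and f(t x) is a rational
    function. Associativity becomes, at generic (t, x), an identity of polynomials in s, whose
    coefficients are then compared in K_X(t). In the opposite direction associativity is checked on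
    points: the weights give P_i(s, t x) = P_i(st, x) / t^m and the same for Q_i, so the powers of t
    cancel in the coordinate P_i / Q_i. Power series in u = t - 1 are handled through polynomial
    truncations. The identities for t^d f come from the fact that, in characteristic zero, t d/dt
    and the constant term determine a series. *)

Section EulerOperator.
Variables (K : fieldType).
Hypothesis charK : [pchar K] =i pred0.

Lemma natf_neq0S n : n.+1%:R != 0 :> K.
Proof. by rewrite ((pcharf0P K).1 charK). Qed.

(* [(1 + u) d/du], that is [t d/dt] for [t = 1 + u]. *)
Definition theta (p : {poly K}) : {poly K} := ('X + 1) * p^`().

Lemma coef_theta p n : (theta p)`_n = n.+1%:R * p`_n.+1 + n%:R * p`_n.
Proof.
rewrite /theta mulrDl mul1r coefD coefXM !coef_deriv !mulr_natl addrC.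
by case: n => [|n]; rewrite ?mulr0n ?coef_deriv.
Qed.

Lemma thetaM p q : theta (p * q) = theta p * q + p * theta q.
Proof. by rewrite /theta derivM mulrDr mulrA mulrCA. Qed.

Lemma theta_XD1_exp m : theta (('X + 1) ^+ m) = ('X + 1) ^+ m *+ m.
Proof.
rewrite /theta deriv_exp derivD derivX derivC addr0 mul1r.
by case: m => [|m]; rewrite ?mulr0n ?mulr0 // mulrnAr -exprS.
Qed.

Lemma coefM_eql (p p' q : {poly K}) n :
  (forall i, (i <= n)%N -> p`_i = p'`_i) -> (p * q)`_n = (p' * q)`_n.
Proof.
move=> H; rewrite !coefM; apply: eq_bigr => i _.
by rewrite H // -ltnS ltn_ord.
Qed.

Lemma coefM_eqr (p q q' : {poly K}) n :
  (forall i, (i <= n)%N -> q`_i = q'`_i) -> (p * q)`_n = (p * q')`_n.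
Proof. by move=> H; rewrite ![p * _]mulrC; exact: coefM_eql. Qed.

(** The coefficient of u^n in [theta p] is (n + 1) p_(n+1) + n p_n and n + 1 is invertible, so a
    series is recovered from its constant term and its image under [theta]. *)
Lemma coef_theta_inj (p q : {poly K}) n : p`_n = q`_n -> (theta p)`_n = (theta q)`_n ->
  p`_n.+1 = q`_n.+1.
Proof.
rewrite !coef_theta => -> /addIr; exact/mulfI/natf_neq0S.
Qed.

Lemma theta_eigen_uniq (l : K) (p q : {poly K}) N :
  p`_0 = q`_0 ->
  (forall n, (n < N)%N -> (theta p)`_n = l * p`_n) ->
  (forall n, (n < N)%N -> (theta q)`_n = l * q`_n) ->
  forall n, (n <= N)%N -> p`_n = q`_n.
Proof.
move=> E0 Ep Eq; elim=> // n IH lt_nN; have En := IH (ltnW lt_nN).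
by apply: coef_theta_inj => //; rewrite Ep // Eq // En.
Qed.

Variable d : K -> K.
Hypothesis dD : {morph d : a b / a + b}.
Hypothesis dM : forall a b, d (a * b) = d a * b + a * d b.

Lemma der0 : d 0 = 0.
Proof. by apply: (addIr (d 0)); rewrite -dD !add0r. Qed.

Lemma derN : {morph d : a / - a}.
Proof. by move=> a; apply: (addIr (d a)); rewrite -dD !addNr der0. Qed.

Lemma der1 : d 1 = 0.
Proof. by apply: (addIr (d 1)); rewrite add0r -{3}[1]mulr1 dM mulr1 mul1r. Qed.

Lemma der_nat n : d n%:R = 0.
Proof. by elim: n => [|n IH]; rewrite ?der0 // -natr1 dD IH der1 addr0. Qed.

(* [falling_der n f] is [d (d - 1) ... (d - n + 1) f / n!], the coefficient of
   [u^n] in [(1 + u)^d f]. *)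
Fixpoint falling_der (n : nat) (f : K) : K :=
  if n is m.+1 then (falling_der m (d f) - m%:R * falling_der m f) / n%:R
  else f.

(** Coefficientwise, this is the equation t g' = t^d (d f) for g = t^d f, where t = 1 + u. *)
Lemma falling_derS n f :
  n.+1%:R * falling_der n.+1 f + n%:R * falling_der n f = falling_der n (d f).
Proof. by rewrite /= mulrCA divff ?natf_neq0S // mulr1 subrK. Qed.

Lemma falling_derD n : {morph falling_der n : f g / f + g}.
Proof.
elim: n => //= n IH f g.
by rewrite dD !IH -mulrDl mulrDr opprD addrACA.
Qed.

Lemma falling_der0 n : falling_der n 0 = 0.
Proof. by apply: (addIr (falling_der n 0)); rewrite -falling_derD !add0r. Qed.

Lemma falling_der_sum n I (r : seq I) (F : I -> K) :
  falling_der n (\sum_(i <- r) F i) = \sum_(i <- r) falling_der n (F i).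
Proof.
exact: (big_morph _ (@falling_derD n) (@falling_der0 n)).
Qed.

Lemma falling_derZ n c f : d c = 0 -> falling_der n (c * f) = c * falling_der n f.
Proof.
move=> dc; elim: n f => //= n IH f.
by rewrite dM dc mul0r add0r !IH mulrCA -mulrBr mulrA.
Qed.

Definition trunc_exp N f : {poly K} := \poly_(n < N) falling_der n f.

Lemma coef_trunc_exp N f n : (n < N)%N -> (trunc_exp N f)`_n = falling_der n f.
Proof. by move=> lt_nN; rewrite coef_poly lt_nN. Qed.

Lemma theta_trunc_exp N f n : (n.+1 < N)%N ->
  (theta (trunc_exp N f))`_n = falling_der n (d f).
Proof.
move=> ltnN; rewrite coef_theta !coef_trunc_exp ?falling_derS //.
exact: ltnW.
Qed.

(** By the Leibniz rule both sides satisfy the same equation for [theta]. The induction keeps f and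
    g free because it calls for the pairs (d f, g) and (f, d g). *)
Lemma trunc_expM N f g n : (n < N)%N ->
  (trunc_exp N f * trunc_exp N g)`_n = falling_der n (f * g).
Proof.
elim: n f g => [|n IH] f g ltnN; first by rewrite coef0M !coef_trunc_exp.
have ltnN' := ltnW ltnN.
rewrite -[RHS](coef_trunc_exp _ ltnN); apply: coef_theta_inj.
  by rewrite IH // coef_trunc_exp.
rewrite theta_trunc_exp // dM falling_derD -!IH // thetaM coefD.
congr (_ + _); [apply: coefM_eql|apply: coefM_eqr] => i le_in;
  by rewrite theta_trunc_exp ?coef_trunc_exp // (leq_ltn_trans _ ltnN) // leqW.
Qed.

(** Here t^d a = t^(j - m) a. The factor t^m keeps both sides polynomial when j < m; both are
    eigenvectors of [theta] for j, with constant term a. *)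
Lemma trunc_exp_eigen N a (j m : nat) : d a = (j%:R - m%:R) * a ->
  forall n, (n < N)%N ->
  (('X + 1) ^+ m * trunc_exp N a)`_n = (a%:P * ('X + 1) ^+ j)`_n.
Proof.
move=> da n ltnN; case: N ltnN => // N; rewrite ltnS.
have X0 l : (('X + 1 : {poly K}) ^+ l)`_0 = 1.
  by rewrite -horner_coef0 horner_exp !hornerE expr1n.
apply: (@theta_eigen_uniq j%:R) => [|i ltiN|i ltiN].
- by rewrite !coef0M !X0 coefC coef_trunc_exp // mul1r mulr1.
- rewrite thetaM theta_XD1_exp coefD mulrnAl coefMn -[_ *+ m]mulr_natl.
  rewrite [X in _ + X](@coefM_eqr _ _ ((j%:R - m%:R) *: trunc_exp N.+1 a)) => [|l le_li].
    by rewrite -scalerAr coefZ -mulrDl addrC subrK.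
  have ltlN : (l < N)%N := leq_ltn_trans le_li ltiN.
  rewrite theta_trunc_exp // da coefZ coef_trunc_exp; last exact: ltnW.
  by rewrite falling_derZ // dD derN !der_nat subrr.
- rewrite thetaM theta_XD1_exp /theta derivC mulr0 mul0r add0r.
  by rewrite mulrnAr coefMn mulr_natl.
Qed.

(** The shift by m lets a polynomial carry negative weights: P(t) / t^m is then t^d P(1). *)
Definition eigenpoly (m : nat) (P : {poly K}) : Prop :=
  forall j, d P`_j = (j%:R - m%:R) * P`_j.

Lemma trunc_exp_eigenpoly N m P : eigenpoly m P -> forall n, (n < N)%N ->
  (('X + 1) ^+ m * trunc_exp N P.[1])`_n = (P \Po ('X + 1))`_n.
Proof.
move=> hP n ltnN; rewrite comp_polyE coef_sum horner_coef.
rewrite (@coefM_eqr _ _ (\sum_(i < size P) trunc_exp N P`_i)); last first.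
  move=> i le_in; have ltiN := leq_ltn_trans le_in ltnN.
  rewrite coef_sum coef_trunc_exp // falling_der_sum; apply: eq_bigr => j _.
  by rewrite coef_trunc_exp // expr1n mulr1.
rewrite mulr_sumr coef_sum; apply: eq_bigr => j _.
by rewrite (trunc_exp_eigen (hP j)) // -mul_polyC.
Qed.

(** Multiplicativity turns f Q(1) = P(1) into t^d f * t^m t^d Q(1) = t^m t^d P(1), that is t^d f *
    Q(t) = P(t). *)
Lemma eigenpoly_expansion m P Q f : eigenpoly m P -> eigenpoly m Q ->
  f * Q.[1] = P.[1] -> forall n,
  \sum_(i < n.+1) (Q \Po ('X + 1))`_i * falling_der (n - i) f
    = (P \Po ('X + 1))`_n.
Proof.
move=> hP hQ fE n.
rewrite -(trunc_exp_eigenpoly hP (ltnSn n)) -fE.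
rewrite (@coefM_eqr _ _ (trunc_exp n.+1 f * trunc_exp n.+1 Q.[1])); last first.
  by move=> i le_in; rewrite coef_trunc_exp // trunc_expM.
rewrite mulrCA mulrC (@coefM_eql _ (Q \Po ('X + 1))); last first.
  by move=> i le_in; rewrite (trunc_exp_eigenpoly hQ) // ltnS.
rewrite coefM; apply: eq_bigr => i _.
by rewrite coef_trunc_exp // ltnS leq_subr.
Qed.

Lemma eigenpoly_add m P Q : eigenpoly m P -> eigenpoly m Q -> eigenpoly m (P + Q).
Proof. by move=> hP hQ j; rewrite coefD dD hP hQ mulrDr. Qed.

Lemma eigenpoly_opp m P : eigenpoly m P -> eigenpoly m (- P).
Proof. by move=> hP j; rewrite coefN derN hP mulrN. Qed.

Lemma der_sum I (r : seq I) (F : I -> K) :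
  d (\sum_(i <- r) F i) = \sum_(i <- r) d (F i).
Proof. exact: (big_morph _ dD der0). Qed.

(** Weights add: (i - m) + (j - i - n) = j - (m + n). *)
Lemma eigenpoly_mul m n P Q : eigenpoly m P -> eigenpoly n Q -> eigenpoly (m + n) (P * Q).
Proof.
move=> hP hQ j; rewrite coefM der_sum mulr_sumr; apply: eq_bigr => i _.
have le_ij : (i <= j)%N by rewrite -ltnS ltn_ord.
rewrite dM hP hQ (natrB _ le_ij) natrD.
move: P`_i Q`_(j - i) => a b; move: i%:R j%:R m%:R n%:R => x y z t.
by ring.
Qed.

Lemma eigenpolyZXn (a : K) (m j : nat) : d a = (j%:R - m%:R) * a -> eigenpoly m (a *: 'X^j).
Proof.
move=> da i; rewrite coefZ coefXn.
by case: eqVneq => [->|_]; [rewrite mulr1|rewrite !mulr0 der0].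
Qed.

End EulerOperator.

(** * Fractions of polynomials *)

Section Fractions.
Variable R : idomainType.
Local Open Scope quotient_scope.

(** [ddt] and [frac_at] are defined through chosen representatives; this identity makes them
    computable on any fraction. *)
Lemma divf_num_den (r : {fraction R}) :
  tofrac \n_(repr r) / tofrac \d_(repr r) = r.
Proof.
have d0 : tofrac \d_(repr r) != 0 by rewrite tofrac_eq0 denom_ratioP.
apply: (mulIf d0); rewrite mulfVK //; apply/esym.
rewrite -[X in X * _]reprK; set x := repr r.
rewrite [LHS](_ : _ = FracField.mul (\pi_(FracField.type R) x) (tofrac \d_x)) //.
rewrite piE [RHS]piE; apply/eqmodP.
rewrite /= FracField.equivfE /FracField.mulf.
by rewrite !numden_Ratio ?mulr1 ?oner_neq0 ?denom_ratioP // mulrC.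
Qed.

Lemma tofrac_div_eq (p q p' q' : R) : q != 0 -> q' != 0 ->
  (tofrac p / tofrac q == tofrac p' / tofrac q') = (p * q' == p' * q).
Proof.
by move=> q0 q'0; rewrite eqr_div ?tofrac_eq0 // -!tofracM tofrac_eq.
Qed.

End Fractions.

Section PolyFractions.
Variable K : fieldType.

Lemma horner_neq0 (p : {poly K}) x : p.[x] != 0 -> p != 0.
Proof. by apply: contraNneq => ->; rewrite horner0. Qed.

Lemma horner1_neq0 (p : {poly K}) : p.[1] != 0 -> p != 0.
Proof. exact: horner_neq0. Qed.

Lemma comp_XaddC1_inj : injective (fun p : {poly K} => p \Po ('X + 1)).
Proof.
move=> p q /= E; rewrite -[p](comp_polyXaddC_K _ 1) -[q](comp_polyXaddC_K _ 1).
by rewrite polyC1 E.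
Qed.

Lemma coef_comp_XaddC1 (p : {poly K}) :
  (p \Po ('X + 1))`_0 = p.[1] /\ (p \Po ('X + 1))`_1 = p^`().[1].
Proof.
split; first by rewrite -horner_coef0 horner_comp !hornerE.
rewrite -[LHS]mulr1n -coef_deriv -horner_coef0 deriv_comp hornerM horner_comp.
by rewrite derivD derivX -polyC1 derivC !hornerE.
Qed.

(** For n = 0 and n = 1 the equations read q(1) s_0 = p(1) and q(1) s_1 + q'(1) s_0 = p'(1); solving
    for s_1 gives the quotient rule. *)
Lemma expansion_coef1 (p q : {poly K}) (s : nat -> K) : q.[1] != 0 ->
  (forall n, \sum_(i < n.+1) (q \Po ('X + 1))`_i * s (n - i)%N
     = (p \Po ('X + 1))`_n) ->
  (p^`().[1] * q.[1] - p.[1] * q^`().[1]) / q.[1] ^+ 2 = s 1%N.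
Proof.
move=> q1 H; have [<- <-] := coef_comp_XaddC1 p.
rewrite -(H 0%N) -(H 1%N) !big_ord_recl !big_ord0 /=.
have [-> ->] := coef_comp_XaddC1 q; field.
exact: q1.
Qed.

(** Both products equal q q' s as power series; cutting s after index n suffices for the coefficient
    of index n. *)
Lemma expansion_uniq (p q p' q' : {poly K}) (s : nat -> K) :
  (forall n, \sum_(i < n.+1) (q \Po ('X + 1))`_i * s (n - i)%N
     = (p \Po ('X + 1))`_n) ->
  (forall n, \sum_(i < n.+1) (q' \Po ('X + 1))`_i * s (n - i)%N
     = (p' \Po ('X + 1))`_n) ->
  p * q' = p' * q.
Proof.
move=> H H'; apply: comp_XaddC1_inj; rewrite /= !comp_polyM.
apply/polyP => n; set S := \poly_(i < n.+1) s i.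
have E (r r' : {poly K}) : (forall n, \sum_(i < n.+1) r`_i * s (n - i)%N = r'`_n) ->
    forall i, (i <= n)%N -> r'`_i = (r * S)`_i.
  move=> Hr i le_in; rewrite -Hr coefM; apply: eq_bigr => j _.
  by rewrite coef_poly ltnS (leq_trans (leq_subr _ _)).
rewrite (@coefM_eql _ _ ((q \Po ('X + 1)) * S)) ?[RHS](@coefM_eql _ _ ((q' \Po ('X + 1)) * S)).
- by rewrite mulrAC [in RHS]mulrAC [(q \Po _) * _]mulrC.
- exact: (E _ _ H').
- exact: (E _ _ H).
Qed.

End PolyFractions.

Section Algebra.
Variables (k : closedFieldType) (X : variety k).
Hypothesis char0 : [pchar k] =i pred0.
Local Notation K := (funfield X).
Local Notation Kt := {fraction {poly K}}.

Lemma ff_cstD a b : ff_cst X (a + b) = ff_cst X a + ff_cst X b.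
Proof. by rewrite [RHS]ff_addE; apply: germ_eqT. Qed.

Lemma ff_cst0 : ff_cst X 0 = 0. Proof. by []. Qed.

Lemma ff_cst1 : ff_cst X 1 = 1. Proof. by []. Qed.

Lemma ff_cst_eq0 c : (ff_cst X c == 0) = (c == 0).
Proof.
apply/eqP/eqP => [/germP[W [_ dW _ H]]|->//].
have [x0 _] := variety_nonempty X.
by have [x [_ /H]] := dW _ (ex_intro _ x0 I) openT.
Qed.

Lemma ff_nat n : n%:R = ff_cst X n%:R.
Proof. by elim: n => // n IH; rewrite -[in RHS]natr1 ff_cstD -IH natr1. Qed.

Lemma funfield_char0 : [pchar K] =i pred0.
Proof.
by apply/pcharf0P => n; rewrite ff_nat ff_cst_eq0 ((pcharf0P k).1 char0).
Qed.

Lemma is_expansion_uniq (r r' : Kt) s :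
  is_expansion r s -> is_expansion r' s -> r = r'.
Proof.
move=> [p [q [q1 -> H]]] [p' [q' [q'1 -> H']]].
apply/eqP; rewrite tofrac_div_eq ?horner1_neq0 //.
exact/eqP/(expansion_uniq H H').
Qed.

Lemma ev1_div (p q : {poly K}) : q.[1] != 0 ->
  ev1 (tofrac p / tofrac q) = p.[1] / q.[1].
Proof.
move=> q1; apply: xget_unique; first by exists p, q.
move=> a [p' [q' [q'1 /eqP + ->]]].
rewrite tofrac_div_eq ?horner1_neq0 // => /eqP /(congr1 (horner^~ 1)).
by rewrite !hornerM => E; apply/eqP; rewrite eqr_div // E.
Qed.

Lemma ddt_div (p q : {poly K}) : q != 0 ->
  ddt (tofrac p / tofrac q) = tofrac (p^`() * q - p * q^`()) / tofrac (q ^+ 2).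
Proof.
move=> q0; rewrite /ddt; move: (divf_num_den (tofrac p / tofrac q)).
set r := repr _; have d0 : \d_r != 0 by exact: denom_ratioP.
move: \n_r \d_r d0 => n d d0 /eqP; rewrite tofrac_div_eq // => /eqP E.
apply/eqP; rewrite tofrac_div_eq ?expf_neq0 //.
(* Differentiate the cross-multiplied equality of the two representatives; the factor d q brings it
   to the shape of the goal. *)
have /(congr1 (fun a => a * (d * q))) := congr1 deriv E.
rewrite !derivM => E'; apply/eqP.
transitivity ((n^`() * q + n * q^`()) * (d * q) - (n * q) * (d^`() * q + d * q^`())).
  by ring.
by rewrite E' E; ring.
Qed.

Lemma ev1_ddt_div (p q : {poly K}) : q.[1] != 0 ->
  ev1 (ddt (tofrac p / tofrac q))
  = (p^`().[1] * q.[1] - p.[1] * q^`().[1]) / q.[1] ^+ 2.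
Proof.
move=> q1; rewrite ddt_div ?horner1_neq0 // ev1_div; last first.
  by rewrite horner_exp expf_neq0.
by rewrite horner_exp !hornerE.
Qed.

Lemma ev1_ddt_expansion (r : Kt) s : is_expansion r s -> ev1 (ddt r) = s 1%N.
Proof.
move=> [p [q [q1 -> H]]]; rewrite ev1_ddt_div //.
exact: expansion_coef1.
Qed.

End Algebra.

(** * The series of log (1 + u) and algebraic coactions *)

Section LogSeries.
Variable K : fieldType.
Hypothesis charK : [pchar K] =i pred0.

Lemma coef_exp_eq (p q : {poly K}) i n :
  (forall j, (j <= n)%N -> p`_j = q`_j) -> (p ^+ i)`_n = (q ^+ i)`_n.
Proof.
move=> H; elim: i n H => // i IH n H; rewrite !exprS !coefM.
apply: eq_bigr => j _; rewrite H ?leq_ord // IH // => l le_l.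
by apply: H; rewrite (leq_trans le_l) ?leq_subr.
Qed.

Lemma coef_exp_lt (p : {poly K}) i n : p`_0 = 0 -> (n < i)%N -> (p ^+ i)`_n = 0.
Proof.
move=> p0; elim: i n => // i IH n lt_ni; rewrite exprS coefM big1 // => j _.
case: (posnP j) => [->|j_gt0]; first by rewrite p0 mul0r.
rewrite IH ?mulr0 // ltn_subLR ?leq_ord //.
by rewrite (leq_trans lt_ni) // -add1n leq_add2r.
Qed.

Definition log1p (N : nat) : {poly K} :=
  \poly_(j < N) (if j == 0 then 0 else (-1) ^+ j.+1 / j%:R).

Lemma coef_log1p0 N : (log1p N)`_0 = 0.
Proof. by rewrite coef_poly; case: ifP. Qed.

(** This is t (log t)' = 1, up to truncation, whence the bound on n. *)
Lemma theta_log1p N n : (n.+1 < N)%N -> (theta (log1p N))`_n = (n == 0)%:R.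
Proof.
move=> ltnN; rewrite coef_theta !coef_poly ltnN (ltnW ltnN) /=.
rewrite mulrCA divff ?natf_neq0S // mulr1.
case: n ltnN => [|n] ltnN /=; first by rewrite mul0r addr0 expr2 mulrN1 opprK.
by rewrite mulrCA divff ?natf_neq0S // mulr1 [in X in X + _]exprS mulN1r addNr.
Qed.

Lemma theta_log1p_exp N i n : (n.+1 < N)%N ->
  (theta (log1p N ^+ i.+1))`_n = i.+1%:R * (log1p N ^+ i)`_n.
Proof.
move=> ltnN; rewrite /theta deriv_exp mulrnAr coefMn mulrA -[LHS]mulr_natl.
congr (_ * _); rewrite -[RHS](congr1 (fun r : {poly K} => r`_n) (mul1r _)).
rewrite -/(theta _); apply: coefM_eql => j le_jn.
by rewrite theta_log1p ?coef1 ?(leq_ltn_trans _ ltnN) //; case: eqP.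
Qed.

Variable d : K -> K.

(** This is exp(log(t) d) = t^d. The left side obeys the recursion [falling_derS] because [theta]
    lowers the power of the logarithm by one, which leaves one more d on f. *)
Lemma subst_log1p n f :
  \sum_(i < n.+1) iter i d f / i`!%:R * (log1p n.+1 ^+ i)`_n = falling_der d n f.
Proof.
elim: n f => [|n IH] f; first by rewrite big_ord1 /= divr1 expr0 coef1 mulr1.
have n1 := natf_neq0S charK n; apply: (mulfI n1).
apply: (addIr (n%:R * falling_der d n f)); rewrite falling_derS // -!IH.
(* Raising the truncation order leaves the coefficient of u^n unchanged and makes room for the index
   n + 1 that [theta] reads. *)
have E g (m : nat) : (n < m)%N -> \sum_(i < n.+1) iter i d g / i`!%:R * (log1p n.+1 ^+ i)`_n
    = \sum_(i < n.+1) iter i d g / i`!%:R * (log1p m ^+ i)`_n.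
  move=> ltnm; apply: eq_bigr => i _; congr (_ * _).
  apply: coef_exp_eq => j le_jn.
  by rewrite !coef_poly ltnS le_jn (leq_ltn_trans le_jn).
rewrite (E f n.+2) // (E (d f) n.+2) // {E IH}.
(* The extra term i = n + 1 is zero because the logarithm has no constant term. *)
have -> : \sum_(i < n.+1) iter i d f / i`!%:R * (log1p n.+2 ^+ i)`_n
    = \sum_(i < n.+2) iter i d f / i`!%:R * (log1p n.+2 ^+ i)`_n.
  by rewrite [RHS]big_ord_recr /= (@coef_exp_lt _ n.+1) ?coef_log1p0 // mulr0 addr0.
rewrite !mulr_sumr -big_split /= big_ord_recl /= expr0 !coef1 mulr0 mulr0 add0r.
rewrite (_ : _ * (_ * (n == 0)%:R) = 0) ?add0r; last first.
  by case: eqP => [->|_]; rewrite ?mul0r ?mulr0.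
apply: eq_bigr => i _; rewrite /bump leq0n add1n.
rewrite mulrCA [X in _ + X]mulrCA -mulrDr -coef_theta theta_log1p_exp //.
rewrite mulrA; congr (_ * _); rewrite -iterSr /= factS natrM invfM -mulrA.
by rewrite [_^-1 * _^-1]mulrC mulfVK ?natf_neq0S.
Qed.

End LogSeries.

Section Coaction.
Variables (k : closedFieldType) (X : variety k).
Hypothesis char0 : [pchar k] =i pred0.
Local Notation K := (funfield X).
Local Notation Kt := {fraction {poly K}}.

Lemma phi_starE d (f : K) n : phi_star d f n = falling_der d n f.
Proof. by rewrite -subst_log1p //; exact: funfield_char0. Qed.

(** The group version of [eigenpoly]: t scales the coefficient P_j by t^(j - m). *)
Definition weighted (c : K -> Kt) (m : nat) (P : {poly K}) : Prop :=
  forall j, c P`_j = tofrac (P`_j *: 'X^j) / tofrac 'X^m.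

(* The purely algebraic content of a rational action.  In the last clause,
   [P] and [Q] split [f] into semi-invariants: [P`_j] and [Q`_j] have weight
   [j - m]. *)
Definition coaction (c : K -> Kt) : Prop :=
  [/\ {morph c : f g / f + g}, {morph c : f g / f * g},
      forall a, c (ff_cst X a) = tofrac (ff_cst X a)%:P &
      forall f, exists m P Q, [/\ Q.[1] != 0, f * Q.[1] = P.[1],
        c f = tofrac P / tofrac Q & weighted c m P /\ weighted c m Q]].

(** The infinitesimal form of the last clause of [coaction]. The functions with this property will
    form a subfield, so that it can be checked on generators. *)
Definition split_by (d : K -> K) (f : K) : Prop :=
  exists m P Q, [/\ Q.[1] != 0, f * Q.[1] = P.[1],
    eigenpoly d m P & eigenpoly d m Q].

End Coaction.

(** * Semisimple derivations and coactions *)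

Section QuotientRule.
Variable F : fieldType.

Lemma quotient_rule_add (p q p' q' dp dq dp' dq' : F) : q != 0 -> q' != 0 ->
  ((dp * q' + p * dq' + (dp' * q + p' * dq)) * (q * q')
   - (p * q' + p' * q) * (dq * q' + q * dq')) / (q * q') ^+ 2
  = (dp * q - p * dq) / q ^+ 2 + (dp' * q' - p' * dq') / q' ^+ 2.
Proof. by move=> q0 q'0; field; rewrite q0 q'0. Qed.

Lemma quotient_rule_mul (p q p' q' dp dq dp' dq' : F) : q != 0 -> q' != 0 ->
  ((dp * p' + p * dp') * (q * q') - (p * p') * (dq * q' + q * dq'))
    / (q * q') ^+ 2
  = (dp * q - p * dq) / q ^+ 2 * (p' / q')
    + p / q * ((dp' * q' - p' * dq') / q' ^+ 2).
Proof. by move=> q0 q'0; field; rewrite q0 q'0. Qed.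

Lemma tofrac_addf (R : idomainType) (p q p' q' : R) : q != 0 -> q' != 0 ->
  tofrac p / tofrac q + tofrac p' / tofrac q'
  = tofrac (p * q' + p' * q) / tofrac (q * q').
Proof.
by move=> q0 q'0; rewrite addf_div ?tofrac_eq0 // tofracD !tofracM.
Qed.

Lemma tofrac_mulf (R : idomainType) (p q p' q' : R) :
  tofrac p / tofrac q * (tofrac p' / tofrac q') = tofrac (p * p') / tofrac (q * q').
Proof. by rewrite mulf_div !tofracM. Qed.

End QuotientRule.

(** * From semisimple derivations to coactions *)

Section FromDerivation.
Variables (k : closedFieldType) (X : variety k).
Hypothesis char0 : [pchar k] =i pred0.
Local Notation K := (funfield X).
Local Notation Kt := {fraction {poly K}}.
Let charK := funfield_char0 X char0.

Variable d : K -> K.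
Hypothesis dss : rational_semisimple d.

Let dD : {morph d : a b / a + b}. Proof. by case: dss => -[]. Qed.
Let dM : forall a b, d (a * b) = d a * b + a * d b.
Proof. by case: dss => -[]. Qed.
Let dC c : d (ff_cst X c) = 0. Proof. by case: dss => -[]. Qed.

Let eigenpoly_der0 f : d f = 0 -> eigenpoly d 0 f%:P.
Proof.
move=> df j; rewrite coefC; case: eqVneq => [->|_].
  by rewrite df subrr mul0r.
by rewrite (der0 dD) mulr0.
Qed.

Let eigenpolyXn m : eigenpoly d m 'X^m.
Proof.
rewrite -['X^m]scale1r; apply: (eigenpolyZXn dD).
by rewrite (der1 dM) subrr mul0r.
Qed.

Lemma split_by_der0 f : d f = 0 -> split_by d f.
Proof.
move=> df; exists 0%N, f%:P, 1%:P; split.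
- by rewrite hornerC oner_neq0.
- by rewrite !hornerC mulr1.
- exact: eigenpoly_der0.
- exact/eigenpoly_der0/der1.
Qed.

Lemma split_byB f g : split_by d f -> split_by d g -> split_by d (f - g).
Proof.
move=> [m [P [Q [Q1 fE hP hQ]]]] [n [P' [Q' [Q'1 gE hP' hQ']]]].
exists (m + n)%N, (P * Q' - P' * Q), (Q * Q'); split.
- by rewrite hornerM mulf_neq0.
- rewrite hornerM hornerD hornerN !hornerM -fE -gE mulrBl.
  by rewrite -!mulrA [Q.[1] * Q'.[1]]mulrC.
- apply: (eigenpoly_add dD); first exact: eigenpoly_mul.
  apply: (eigenpoly_opp dD); rewrite addnC; exact: eigenpoly_mul.
- exact: eigenpoly_mul.
Qed.

Lemma split_by_div f g : split_by d f -> split_by d g -> split_by d (f / g).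
Proof.
move=> [m [P [Q [Q1 fE hP hQ]]]] [n [P' [Q' [Q'1 gE hP' hQ']]]].
have [->|g0] := eqVneq g 0.
  by rewrite invr0 mulr0; apply: split_by_der0; exact: der0.
exists (m + n)%N, (P * Q'), (Q * P'); split.
- by rewrite hornerM -gE !mulf_neq0.
- rewrite !hornerM -fE -gE mulrA -!mulrA; congr (f * _).
  by rewrite mulrCA mulKf.
- exact: eigenpoly_mul.
- exact: eigenpoly_mul.
Qed.

Lemma split_by_eigen f (l : int) : d f = l%:~R * f -> split_by d f.
Proof.
(* A weight n >= 0 sits on t^n in the numerator, with m = 0; a weight -(n + 1) sits on t^0 over the
   denominator t^(n + 1), with m = n + 1. *)
case: l => n df.
  exists 0%N, (f *: 'X^n), 1; split.
  - by rewrite hornerC oner_neq0.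
  - by rewrite hornerC hornerZ hornerXn expr1n.
  - by apply: (eigenpolyZXn dD); rewrite df subr0.
  - exact/eigenpoly_der0/der1.
exists n.+1, (f *: 'X^0), 'X^(n.+1); split.
- by rewrite hornerXn expr1n oner_neq0.
- by rewrite hornerZ !hornerXn !expr1n.
- by apply: (eigenpolyZXn dD); rewrite df sub0r NegzE mulrNz.
- exact: eigenpolyXn.
Qed.

Lemma semisimple_split f : split_by d f.
Proof.
case: dss => _ [I [a [l [gen_a da]]]].
have /asboolP : f \in [pred g | `[< split_by d g >]].
  apply: gen_a => [|i]; last by apply/asboolP; apply: split_by_eigen (da i).
  split => [|g h /asboolP sg /asboolP sh|g h /asboolP sg /asboolP sh].
  - by apply/asboolP/split_by_der0/der1.
  - exact/asboolP/split_byB.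
  - exact/asboolP/split_by_div.
by [].
Qed.

Let expansion_div m P Q f : Q.[1] != 0 -> f * Q.[1] = P.[1] ->
  eigenpoly d m P -> eigenpoly d m Q ->
  is_expansion (tofrac P / tofrac Q) (phi_star d f).
Proof.
move=> Q1 fE hP hQ; exists P, Q; split=> // n.
rewrite -(eigenpoly_expansion charK dD dM hP hQ fE); apply: eq_bigr => i _.
by rewrite phi_starE.
Qed.

Lemma exp_coaction : exists c : K -> Kt,
  coaction c /\ forall f, is_expansion (c f) (phi_star d f).
Proof.
have exE f : exists r : Kt, is_expansion r (phi_star d f).
  have [m [P [Q [Q1 fE hP hQ]]]] := semisimple_split f.
  by exists (tofrac P / tofrac Q); exact: expansion_div fE hP hQ.
pose c f := projT1 (cid (exE f)).
have cP f : is_expansion (c f) (phi_star d f) by rewrite /c; case: cid.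
exists c; split=> //.
(* By uniqueness of expansions [c f] may be computed from any splitting of f, so each law amounts to
   recognising a fraction as a splitting. *)
have cE f m P Q : Q.[1] != 0 -> f * Q.[1] = P.[1] ->
    eigenpoly d m P -> eigenpoly d m Q -> c f = tofrac P / tofrac Q.
  move=> Q1 fE hP hQ; apply: is_expansion_uniq (cP f) _.
  exact: expansion_div hP hQ.
split=> [f g|f g|a|f].
- have [m [P [Q [Q1 fE hP hQ]]]] := semisimple_split f.
  have [n [P' [Q' [Q'1 gE hP' hQ']]]] := semisimple_split g.
  rewrite (cE f m P Q) // (cE g n P' Q') // tofrac_addf ?horner1_neq0 //.
  apply: (cE _ (m + n)%N).
  + by rewrite hornerM mulf_neq0.
  + rewrite hornerD !hornerM -fE -gE mulrDl.
    by rewrite -!mulrA [Q.[1] * Q'.[1]]mulrC.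
  + apply: (eigenpoly_add dD); first exact: eigenpoly_mul.
    by rewrite addnC; exact: eigenpoly_mul.
  + exact: eigenpoly_mul.
- have [m [P [Q [Q1 fE hP hQ]]]] := semisimple_split f.
  have [n [P' [Q' [Q'1 gE hP' hQ']]]] := semisimple_split g.
  rewrite (cE f m P Q) // (cE g n P' Q') // tofrac_mulf.
  apply: (cE _ (m + n)%N).
  + by rewrite hornerM mulf_neq0.
  + by rewrite !hornerM -fE -gE mulrACA.
  + exact: eigenpoly_mul.
  + exact: eigenpoly_mul.
- rewrite (cE _ 0%N (ff_cst X a)%:P 1%:P) ?polyC1 ?tofrac1 ?divr1 //.
  + by rewrite hornerC oner_neq0.
  + by rewrite !hornerC mulr1.
  + exact/eigenpoly_der0/dC.
- have [m [P [Q [Q1 fE hP hQ]]]] := semisimple_split f.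
  exists m, P, Q; split=> //; first exact: cE hP hQ.
  (* P_j itself splits as P_j t^j over t^m, and likewise Q_j. *)
  by split=> j; apply: cE; rewrite ?hornerZ ?hornerXn ?expr1n ?oner_neq0 //;
    exact: (eigenpolyZXn dD).
Qed.

End FromDerivation.

(** * From coactions to semisimple derivations *)

Section FromCoaction.
Variables (k : closedFieldType) (X : variety k).
Hypothesis char0 : [pchar k] =i pred0.
Local Notation K := (funfield X).
Local Notation Kt := {fraction {poly K}}.
Let charK := funfield_char0 X char0.

Variable c : K -> Kt.
Hypothesis cco : coaction c.
Let D f := ev1 (ddt (c f)).

Let cD : {morph c : f g / f + g}. Proof. by case: cco. Qed.
Let cM : {morph c : f g / f * g}. Proof. by case: cco. Qed.

Let c_div f : exists P Q, [/\ Q.[1] != 0, f = P.[1] / Q.[1] &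
  c f = tofrac P / tofrac Q].
Proof.
case: cco => _ _ _ /(_ f)[m [P [Q [Q1 fE cE _]]]].
by exists P, Q; split=> //; rewrite -fE mulfK.
Qed.

(** d/dt followed by [ev1] is a derivation along evaluation at t = 1, and the value of c f at 1 is
    f; the latter enters the Leibniz rule as f = P(1) / Q(1). *)
Lemma coaction_derivation : derivation D.
Proof.
split=> [f g|f g|a].
- have [P [Q [Q1 _ fE]]] := c_div f; have [P' [Q' [Q'1 _ gE]]] := c_div g.
  rewrite /D cD fE gE tofrac_addf ?horner1_neq0 // !ev1_ddt_div ?hornerM ?mulf_neq0 //.
  by rewrite derivD !derivM !hornerD !hornerM quotient_rule_add.
- have [P [Q [Q1 f1 fE]]] := c_div f; have [P' [Q' [Q'1 g1 gE]]] := c_div g.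
  rewrite /D cM fE gE tofrac_mulf // !ev1_ddt_div ?hornerM ?mulf_neq0 //.
  by rewrite !derivM !hornerD !hornerM quotient_rule_mul // f1 g1.
- case: cco => _ _ cC _; rewrite /D cC -[tofrac _]divr1 -tofrac1 -polyC1.
  by rewrite ev1_ddt_div ?hornerC ?oner_neq0 // !derivC !horner0 mul0r mulr0 subrr mul0r.
Qed.

Let weighted_eigenpoly m P : weighted c m P -> eigenpoly D m P.
Proof.
move=> wP j; rewrite /D wP ev1_ddt_div; last by rewrite hornerXn expr1n oner_neq0.
rewrite derivZ !derivXn !hornerZ !hornerMn !hornerXn !expr1n !mulr1 divr1.
by rewrite -mulrBr mulrC.
Qed.

Let split_D f : split_by D f.
Proof.
case: cco => _ _ _ /(_ f)[m [P [Q [Q1 fE _ [/weighted_eigenpoly hP /weighted_eigenpoly hQ]]]]].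
by exists m, P, Q.
Qed.

Lemma coaction_semisimple : rational_semisimple D.
Proof.
split; first exact: coaction_derivation.
(* All eigenvectors with integral eigenvalue serve as generators; the coefficients of P and Q are
   among them. *)
pose I := {al : K * int | D al.1 = al.2%:~R * al.1}.
exists I, (fun i => (sval i).1), (fun i => (sval i).2); split; last by case.
move=> F clF aF f.
have FX P m : eigenpoly D m P -> P.[1] \in F.
  move=> hP; rewrite horner_coef.
  have [F1 FB _] := clF; have F0 : 0 \in F by rewrite -(subrr 1) FB.
  elim/big_ind: _ => // [x y Fx Fy|j _].
    by rewrite -[y]opprK -[- y]sub0r FB // FB.
  rewrite expr1n mulr1.
  have Ej : D P`_j = (j%:Z - m%:Z)%:~R * P`_j by rewrite hP intrB.
  exact: aF (exist _ (P`_j, j%:Z - m%:Z) Ej).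
have [m [P [Q [Q1 fE hP hQ]]]] := split_D f.
rewrite -[f](mulfK Q1) fE; case: clF => _ _; apply; exact: FX hP || exact: FX hQ.
Qed.

Lemma coaction_expansion f : is_expansion (c f) (phi_star D f).
Proof.
case: cco => _ _ _ /(_ f)[m [P [Q [Q1 fE -> [/weighted_eigenpoly hP /weighted_eigenpoly hQ]]]]].
have [dD dM _] := coaction_derivation.
exists P, Q; split=> // n.
rewrite -(eigenpoly_expansion charK dD dM hP hQ fE); apply: eq_bigr => i _.
by rewrite phi_starE.
Qed.

Lemma coaction_ord1 f : ord1_ge0 (c f).
Proof. by have [P [Q [Q1 _ ->]]] := c_div f; exists P, Q. Qed.

End FromCoaction.

(** * Spaces with functions *)

Local Open Scope classical_set_scope.

Section Generic.
Variable T : topologicalType.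
Implicit Types P Q : T -> Prop.

Definition generically P : Prop :=
  exists W : set T, [/\ open W, dense W & forall x, W x -> P x].

Lemma generic_all P : (forall x, P x) -> generically P.
Proof. by move=> H; exists setT; split=> //; [exact: openT|exact: denseT]. Qed.

Lemma generic_mono P Q : (forall x, P x -> Q x) -> generically P -> generically Q.
Proof. by move=> PQ [W [oW dW WP]]; exists W; split=> // x /WP/PQ. Qed.

Lemma generic_and P Q : generically P -> generically Q ->
  generically (fun x => P x /\ Q x).
Proof.
move=> [W [oW dW WP]] [W' [oW' dW' WQ]]; exists (W `&` W'); split.
- exact: openI.
- exact: dense_setI.
- by move=> x [/WP ? /WQ].
Qed.

Lemma generic_forall (n : nat) (F : nat -> T -> Prop) :
  (forall i, (i < n)%N -> generically (F i)) ->
  generically (fun x => forall i, (i < n)%N -> F i x).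
Proof.
elim: n => [|n IH] H; first exact: generic_all.
have := generic_and (IH (fun i lt_in => H i (ltnW lt_in))) (H n (ltnSn n)).
apply: generic_mono => x [Hx Hn] i; rewrite ltnS leq_eqVlt => /orP[/eqP->//|].
exact: Hx.
Qed.

Lemma generic_forall_ord (n : nat) (F : 'I_n -> T -> Prop) :
  (forall i, generically (F i)) -> generically (fun x => forall i, F i x).
Proof.
move=> H.
have := @generic_forall n (fun j x => forall i : 'I_n, i = j :> nat -> F i x).
case=> [j lt_jn|W [oW dW WF]].
  have [W [oW dW WF]] := H (Ordinal lt_jn); exists W; split=> // x Wx i ij.
  by rewrite (_ : i = Ordinal lt_jn); [exact: WF|exact: val_inj].
by exists W; split=> // x Wx i; exact: (WF x Wx i).
Qed.

Lemma generic_meet P (O : set T) : generically P -> open O -> O !=set0 ->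
  exists x, O x /\ P x.
Proof. by move=> [W [oW dW WP]] oO /dW/(_ oO)[x [Ox Wx]]; exists x; auto. Qed.

Lemma open_local (A : set T) :
  (forall x, A x -> exists B, [/\ open B, B x & B `<=` A]) -> open A.
Proof.
move=> H; rewrite (_ : A = \bigcup_(B in [set B | open B /\ B `<=` A]) B).
  by apply: bigcup_open => B [].
apply/seteqP; split=> [x /H[B [oB Bx BA]]|x [B [_ BA] /BA]//].
by exists B.
Qed.

Lemma open_forall_ord (n : nat) (F : 'I_n -> set T) :
  (forall i, open (F i)) -> open [set x | forall i, F i x].
Proof.
elim: n F => [|n IH] F oF.
  rewrite (_ : [set _ | _] = setT); first exact: openT.
  by apply/seteqP; split=> // x _ [].
rewrite (_ : [set _ | _] = F ord0 `&` [set x | forall i, F (lift ord0 i) x]).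
  by apply: openI; [exact: oF|exact: IH].
apply/seteqP; split=> [x H|x [H0 H] i]; first by split=> //= i.
by case: (unliftP ord0 i) => [j ->|->].
Qed.

Definition irreducible_space : Prop :=
  forall U V : set T, open U -> open V -> U !=set0 -> V !=set0 -> U `&` V !=set0.

Hypothesis irrT : irreducible_space.

Lemma irreducible_generic (O : set T) P : open O -> O !=set0 ->
  (forall x, O x -> P x) -> generically P.
Proof.
move=> oO O0 OP; exists O; split=> // V V0 oV; exact: irrT oV oO V0 O0.
Qed.

End Generic.

Section Regular.
Variables (k : fieldType) (X : fspace k).
Implicit Types U V : set X.

Lemma reg_ext U (f g : X -> k) : open U -> reg U f ->
  (forall x, U x -> f x = g x) -> reg U g.
Proof.
move=> oU rf fg; apply: reg_local => // x Ux; exists U, f; split=> // y Uy.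
by rewrite fg.
Qed.

Lemma reg_sum U (I : Type) (r : seq I) (F : I -> X -> k) : open U ->
  (forall i, reg U (F i)) -> reg U (fun x => \sum_(i <- r) F i x).
Proof.
move=> oU rF; elim: r => [|i r IH].
  apply: (reg_ext oU (reg_cst 0 oU)) => x _; by rewrite big_nil.
by apply: (reg_ext oU (reg_add oU (rF i) IH)) => x _; rewrite big_cons.
Qed.

Lemma reg_prod U (I : Type) (r : seq I) (F : I -> X -> k) : open U ->
  (forall i, reg U (F i)) -> reg U (fun x => \prod_(i <- r) F i x).
Proof.
move=> oU rF; elim: r => [|i r IH].
  apply: (reg_ext oU (reg_cst 1 oU)) => x _; by rewrite big_nil.
by apply: (reg_ext oU (reg_mul oU (rF i) IH)) => x _; rewrite big_cons.
Qed.

Lemma reg_exp U (f : X -> k) n : open U -> reg U f -> reg U (fun x => f x ^+ n).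
Proof.
move=> oU rf; have := @reg_prod U _ (iota 0 n) (fun=> f) oU (fun=> rf).
by move/(reg_ext oU); apply=> x _; rewrite big_const_seq count_predT size_iota
  -Monoid.iteropE.
Qed.

Lemma reg_neq0_open U (f : X -> k) : open U -> reg U f ->
  open (U `&` [set x | f x != 0]).
Proof. by move=> oU /(reg_inv oU)[]. Qed.

Lemma reg_div U (f g : X -> k) : open U -> reg U f -> reg U g ->
  reg (U `&` [set x | g x != 0]) (fun x => f x / g x).
Proof.
move=> oU rf rg; have [oU' rg'] := reg_inv oU rg.
by apply: reg_mul => //; apply: reg_sub rf => // x [].
Qed.

(** The locus f != 0 is open in U; a point of it would force it to meet the dense set where f
    vanishes. Generic identities are thereby promoted to all points of U. *)
Lemma reg_zero U (f : X -> k) : open U -> reg U f ->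
  generically (fun x => U x -> f x = 0) -> forall x, U x -> f x = 0.
Proof.
move=> oU rf gf x Ux; apply/eqP; apply: contrapT => /negP fx.
have [|y [[Uy /eqP fy] H]] := generic_meet gf (reg_neq0_open oU rf).
  by exists x.
by apply: fy; exact: H.
Qed.

End Regular.

(** * Slices and irreducibility of products *)

Section Products.
Variables (k : fieldType) (Y X : fspace k).
Implicit Types (U : set Y) (V : set X) (W : set (zprod Y X)).

Lemma zprod_openP W : open W <-> forall y x, W (y, x) ->
  exists U V f, [/\ open U, open V, U y, V x & [/\ tensor U V f,
    f (y, x) != 0 & forall z, U z.1 -> V z.2 -> f z != 0 -> W z]].
Proof.
rewrite openbE; split=> [oW y x /oW|H [y x] /H].
  move=> [D [f [[U [V [oU oV -> tf]]] [/= Uy Vx] fz H]]].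
  by exists U, V, f; split=> //; split=> // z Uz Vz; exact: H.
move=> [U [V [f [oU oV Uy Vx [tf fz fW]]]]].
exists (U `*` V), f; split=> //; first by exists U, V.
by move=> z [Uz Vz]; exact: fW.
Qed.

Lemma open_setX U V : open U -> open V -> open (U `*` V : set (zprod Y X)).
Proof.
move=> oU oV; apply/zprod_openP => y x [/= Uy Vx].
exists U, V, (fun=> 1); split=> //; split=> //; last exact: oner_neq0.
by apply: (@tensor_fst _ _ _ _ _ (fun=> 1)); exact: reg_cst.
Qed.

Lemma reg_tensor U V f : open U -> open V -> tensor U V f ->
  reg (U `*` V : set (zprod Y X)) f.
Proof.
move=> oU oV tf z UVz.
exists (U `*` V), (U `*` V), setT, f, (fun=> 1); split=> //.
- exact: open_setX.
- by split; [exists U, V|exact: bas_cst].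
- by move=> y UVy; split=> //; rewrite ?oner_neq0 ?divr1.
Qed.

Lemma reg_fst U V (a : Y -> k) : open U -> open V -> reg U a ->
  reg (U `*` V : set (zprod Y X)) (fun z => a z.1).
Proof. by move=> oU oV ra; apply: reg_tensor => //; exact: tensor_fst. Qed.

Lemma reg_snd U V (b : X -> k) : open U -> open V -> reg V b ->
  reg (U `*` V : set (zprod Y X)) (fun z => b z.2).
Proof. by move=> oU oV rb; apply: reg_tensor => //; exact: tensor_snd. Qed.

Lemma tensor_slice_fst U V f x : open U -> tensor U V f -> V x ->
  reg U (fun y => f (y, x)).
Proof.
move=> oU tf Vx; elim: tf => //= [b _|g h _ rg _ rh|g h _ rg _ rh].
- exact: reg_cst.
- exact: reg_add.
- exact: reg_mul.
Qed.

Lemma tensor_slice_snd U V f y : open V -> tensor U V f -> U y ->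
  reg V (fun x => f (y, x)).
Proof.
move=> oV tf Uy; elim: tf => //= [a _|g h _ rg _ rh|g h _ rg _ rh].
- exact: reg_cst.
- exact: reg_add.
- exact: reg_mul.
Qed.

Lemma open_slice_fst W x : open W -> open [set y | W (y, x)].
Proof.
move=> /zprod_openP oW; apply: open_local => y /oW.
move=> [U [V [f [oU oV Uy Vx [tf fz H]]]]].
exists (U `&` [set y' | f (y', x) != 0]); split=> //.
  exact/reg_neq0_open/(tensor_slice_fst oU tf Vx).
by move=> y' [Uy' fy']; exact: H.
Qed.

Lemma open_slice_snd W y : open W -> open [set x | W (y, x)].
Proof.
move=> /zprod_openP oW; apply: open_local => x /oW.
move=> [U [V [f [oU oV Uy Vx [tf fz H]]]]].
exists (V `&` [set x' | f (y, x') != 0]); split=> //.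
  exact/reg_neq0_open/(tensor_slice_snd oV tf Uy).
by move=> x' [Vx' fx']; exact: H.
Qed.

Lemma open_proj_snd W : open W -> open [set x | exists y, W (y, x)].
Proof.
move=> oW; apply: open_local => x [y Wyx].
exists [set x | W (y, x)]; split=> //; first exact: open_slice_snd.
by move=> x' ?; exists y.
Qed.

Hypotheses (irrY : irreducible_space Y) (irrX : irreducible_space X).

(** Open sets of [zprod] need not be unions of boxes, but their slices and projections are open: the
    two projections to X meet at some x0, and then the slices over x0 meet in Y. *)
Lemma zprod_irreducible : irreducible_space (zprod Y X).
Proof.
move=> W W' oW oW' [[y x] Wyx] [[y' x'] Wyx'].
have [||x0 [[y0 W0] [y0' W0']]] :=
  irrX (open_proj_snd oW) (open_proj_snd oW').
- by exists x, y.
- by exists x', y'.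
have [||y1 [W1 W1']] := irrY (open_slice_fst x0 oW) (open_slice_fst x0 oW').
- by exists y0.
- by exists y0'.
by exists (y1, x0).
Qed.

(** The slices of a dense open set are open, and nonempty over an open set of x; irreducibility
    makes both dense. The points [y0] and [x0] witness that the spaces are inhabited. *)
Lemma generic_slice (P : zprod Y X -> Prop) (y0 : Y) (x0 : X) : generically P ->
  generically (fun x => generically (fun y => P (y, x))).
Proof.
move=> [W [oW dW WP]].
have [[y x] [_ Wz]] := dW setT (ex_intro _ (y0, x0) I) openT.
apply: (irreducible_generic irrX (open_proj_snd oW)); first by exists x, y.
move=> x' [y' W']; apply: (irreducible_generic irrY (open_slice_fst x' oW)).
  by exists y'.
by move=> ? /WP.
Qed.

Lemma generic_snd (P : X -> Prop) (y0 : Y) (x0 : X) : generically P ->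
  generically (fun z : zprod Y X => P z.2).
Proof.
move=> [W [oW dW WP]].
have [x [_ Wx]] := dW setT (ex_intro _ x0 I) openT.
apply: (irreducible_generic zprod_irreducible (open_setX openT oW)).
  by exists (y0, x).
by move=> z [_ /WP].
Qed.

End Products.

(** * The torus *)

Section Torus.
Variable k : fieldType.
Hypothesis char0 : [pchar k] =i pred0.
Local Notation Gm := (Gm k).

Lemma Gm_nonroot (p : {poly k}) : p != 0 -> exists t : Gm, p.[sval t] != 0.
Proof.
move=> p0; apply: contrapT => H.
(* In characteristic zero 1, ..., size p are nonzero and pairwise distinct: one more than the degree
   of p. *)
pose rs := [seq n.+1%:R : k | n <- iota 0 (size p)].
suff : (size rs < size p)%N by rewrite size_map size_iota ltnn.
apply: max_poly_roots => //.
  apply/allP => _ /mapP[n _ ->]; rewrite /root; apply: contrapT => /negP pn.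
  by apply: H; exists (exist _ n.+1%:R (natf_neq0S char0 n)).
rewrite map_inj_uniq ?iota_uniq // => m n /eqP; rewrite -subr_eq0.
case: (leqP m n) => [le_mn|/ltnW le_nm].
  rewrite -oppr_eq0 opprB -natrB ?ltnS // subSS ((pcharf0P k).1 char0).
  by rewrite subn_eq0 => le_nm; apply/eqP; rewrite eqn_leq le_mn.
rewrite -natrB ?ltnS // subSS ((pcharf0P k).1 char0) subn_eq0 => le_mn.
by apply/eqP; rewrite eqn_leq le_mn.
Qed.

Lemma Gm_openP (W : set Gm) : open W <-> forall t, W t ->
  exists p : {poly k}, p.[sval t] != 0 /\ forall s : Gm, p.[sval s] != 0 -> W s.
Proof.
rewrite openbE; split=> [oW t /oW[D [_ [[-> [p ->]] _ pt H]]]|H t /H[p [pt Hp]]].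
  by exists p; split=> // s; exact: H.
exists setT, (fun s => p.[sval s]); split=> //; first by split=> //; exists p.
by move=> s _; exact: Hp.
Qed.

Lemma Gm_irreducible : irreducible_space Gm.
Proof.
move=> U V /Gm_openP oU /Gm_openP oV [t /oU[p [/horner_neq0 p0 pU]]].
move=> [s /oV[q [/horner_neq0 q0 qV]]].
have [r] := Gm_nonroot (mulf_neq0 p0 q0).
by rewrite hornerM mulf_eq0 negb_or => /andP[/pU ? /qV ?]; exists r.
Qed.

Lemma Gm_genericP (P : Gm -> Prop) : generically P <->
  exists p : {poly k}, p != 0 /\ forall s : Gm, p.[sval s] != 0 -> P s.
Proof.
split=> [[W [/Gm_openP oW dW WP]]|[p [p0 pP]]].
  have [t [_ /oW[p [/horner_neq0 p0 pW]]]] := dW setT (ex_intro _ (gm1 k) I) openT.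
  by exists p; split=> // s /pW/WP.
have [t pt] := Gm_nonroot p0.
apply: (irreducible_generic Gm_irreducible (O := [set s | p.[sval s] != 0])) => //.
  by apply/Gm_openP => s ps; exists p.
by exists t.
Qed.

Lemma Gm_generic_poly (p q : {poly k}) :
  generically (fun s : Gm => p.[sval s] = q.[sval s]) -> p = q.
Proof.
move=> /Gm_genericP[r [r0 H]]; apply/eqP; rewrite -subr_eq0.
apply: contrapT => /negP pq; have [t] := Gm_nonroot (mulf_neq0 r0 pq).
rewrite hornerM hornerD hornerN mulf_eq0 negb_or => /andP[/H->].
by rewrite subrr eqxx.
Qed.

Lemma Gm_generic_translate (t : Gm) (P : Gm -> Prop) :
  generically P -> generically (fun s : Gm => P (gm_mul s t)).
Proof.
move=> /Gm_genericP[p [p0 pP]]; apply/Gm_genericP.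
exists (p \Po (sval t *: 'X)); split.
  rewrite comp_poly_eq0 // size_scale ?size_polyX //; exact: (svalP t).
by move=> s; rewrite horner_comp hornerZ hornerX mulrC; exact: (pP (gm_mul s t)).
Qed.

Lemma reg_Gm_coord : reg setT (fun t : Gm => sval t).
Proof.
move=> t _; exists setT, setT, setT, (fun s => 'X.[sval s]), (fun=> 1); split=> //.
- exact: openT.
- by split; [split=> //; exists 'X|exact: bas_cst].
- by move=> s _; split=> //; rewrite ?oner_neq0 ?divr1 ?hornerX.
Qed.

Lemma reg_Gm_local (U : set Gm) (a : Gm -> k) t0 : reg U a -> U t0 ->
  exists (V : set Gm) (p q : {poly k}), [/\ open V, V t0, V `<=` U &
    forall t, V t -> q.[sval t] != 0 /\ a t = p.[sval t] / q.[sval t]].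
Proof.
move=> ra /ra[V [D [E [_ [_ [oV Vt VU [[_ [p ->]] [_ [q ->]]] H]]]]]].
by exists V, p, q; split=> // t /H[].
Qed.

End Torus.

(** * Values of rational functions at generic points *)

Section Values.
Variables (k : closedFieldType) (X : variety k).
Hypothesis char0 : [pchar k] =i pred0.
Local Notation K := (funfield X).
Local Notation Kt := {fraction {poly K}}.
Local Notation GX := (zprod (Gm k) X).
Local Notation cls := (\pi_(funfield X)%qT).
Implicit Types (p q : {poly K}) (z : GX).

(* The value of a rational function: that of a fixed representative, hence
   well behaved only at a generic point. *)
Definition ffval (a : K) (x : X) : k := gfun (repr a) x.

Lemma variety_irr : irreducible_space X.
Proof. exact: variety_irreducible. Qed.

Lemma GX_irr : irreducible_space GX.
Proof. exact/zprod_irreducible/variety_irr/Gm_irreducible. Qed.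

Lemma ffval_cls (g : germ X) : generically (fun x =>
  [/\ gdom g x, gdom (repr (cls g)) x & ffval (cls g) x = g x]).
Proof.
have [W [oW dW WD H]] := repr_agree g; exists W; split=> // x Wx.
by have [? ?] := WD x Wx; split=> //; exact: H.
Qed.

Lemma ffval_dom (a : K) : generically (gdom (repr a)).
Proof.
by exists (gdom (repr a)); split=> //; [exact: gdom_open|exact: gdom_dense].
Qed.

Lemma ffvalD (a b : K) :
  generically (fun x => ffval (a + b) x = ffval a x + ffval b x).
Proof. by apply: generic_mono (ffval_cls (germ_add (repr a) (repr b))) => x [_ _ E]; exact: E. Qed.

Lemma ffvalM (a b : K) :
  generically (fun x => ffval (a * b) x = ffval a x * ffval b x).
Proof. by apply: generic_mono (ffval_cls (germ_mul (repr a) (repr b))) => x [_ _ E]; exact: E. Qed.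

Lemma ffval_cst c : generically (fun x => ffval (ff_cst X c) x = c).
Proof. by apply: generic_mono (ffval_cls (germ_cst X c)) => x [_ _ E]; exact: E. Qed.

Lemma ffval_inj (a b : K) : generically (fun x => ffval a x = ffval b x) -> a = b.
Proof.
move=> [W [oW dW H]]; rewrite -[a]reprK -[b]reprK.
by apply: (germ_eqP oW dW) => x /H.
Qed.

Lemma ffval_neq0 (a : K) : a != 0 -> generically (fun x => ffval a x != 0).
Proof.
move=> a0; have := generic_and (ffvalM a^-1 a) (ffval_cst 1).
apply: generic_mono => x [+ E1]; rewrite mulVf // -ff_cst1 E1 => E.
by apply/eqP => ax0; move/eqP: E; rewrite ax0 mulr0 oner_eq0.
Qed.

Lemma ffval_sum (n : nat) (F : nat -> K) : generically (fun x =>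
  ffval (\sum_(i < n) F i) x = \sum_(i < n) ffval (F i) x).
Proof.
elim: n => [|n IH].
  by apply: generic_mono (ffval_cst 0) => x E; rewrite !big_ord0.
apply: generic_mono (generic_and (ffvalD (\sum_(i < n) F i) (F n)) IH).
by move=> x [E1 E2]; rewrite !big_ord_recr /= E1 E2.
Qed.

(** At a given x this need not respect sums and products, since representatives are chosen
    independently; it does so at generic x. *)
Definition eval_coefs (x : X) (p : {poly K}) : {poly k} :=
  \poly_(i < size p) ffval p`_i x.

Lemma poly_atE p (t : Gm k) (x : X) :
  poly_at p ((t, x) : GX) = (eval_coefs x p).[sval t].
Proof. by rewrite horner_poly. Qed.

Lemma coef_eval_coefs p :
  generically (fun x => forall i, (eval_coefs x p)`_i = ffval p`_i x).
Proof.
(* Beyond the size of p the coefficient is 0 in K_X, whose chosen representative is known to vanish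
   only generically. *)
apply: generic_mono (ffval_cst 0) => x E i; rewrite coef_poly.
by case: ltnP => // /(nth_default 0)->.
Qed.

Lemma eval_coefsD p q : generically (fun x =>
  eval_coefs x (p + q) = eval_coefs x p + eval_coefs x q).
Proof.
have H := generic_forall (n := maxn (size p) (size q)) (fun i _ => ffvalD p`_i q`_i).
have := generic_and H (generic_and (coef_eval_coefs (p + q))
  (generic_and (coef_eval_coefs p) (coef_eval_coefs q))).
apply: generic_mono => x [Hx [Epq [Ep Eq]]]; apply/polyP => i.
rewrite coefD; case: (ltnP i (maxn (size p) (size q))) => [lti|lei].
  by rewrite Epq Ep Eq coefD Hx.
rewrite !coef_poly !ltnNge (leq_trans (size_polyD _ _) lei) /=.
by move: lei; rewrite geq_max => /andP[-> ->]; rewrite addr0.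
Qed.

Lemma eval_coefsM p q : generically (fun x =>
  eval_coefs x (p * q) = eval_coefs x p * eval_coefs x q).
Proof.
have H1 i : generically (fun x => ffval (p * q)`_i x
    = \sum_(j < i.+1) ffval p`_j x * ffval q`_(i - j) x).
  rewrite coefM.
  have := generic_and (ffval_sum i.+1 (fun j => p`_j * q`_(i - j)))
    (generic_forall (n := i.+1) (fun j _ => ffvalM p`_j q`_(i - j))).
  apply: generic_mono => x [-> H]; apply: eq_bigr => j _; exact: H.
(* Only finitely many indices carry a condition, which keeps it generic. *)
have H := generic_forall (n := (size p + size q)%N) (fun i _ => H1 i).
have := generic_and H (generic_and (coef_eval_coefs (p * q))
  (generic_and (coef_eval_coefs p) (coef_eval_coefs q))).
apply: generic_mono => x [Hx [Epq [Ep Eq]]]; apply/polyP => i.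
case: (ltnP i (size p + size q)) => [lti|lei].
  by rewrite Epq Hx // coefM; apply: eq_bigr => j _; rewrite Ep Eq.
rewrite coef_poly ltnNge (leq_trans (size_polyMleq _ _)) ?(leq_trans (leq_pred _)) //=.
rewrite coefM big1 // => j _; rewrite !coef_poly.
case: ltnP => [ltj|]; last by rewrite mul0r.
rewrite ifN ?mulr0 // -leqNgt leq_subRL ?leq_ord //.
by rewrite (leq_trans _ lei) // leq_add2r ltnW.
Qed.

Lemma eval_coefsC a : generically (fun x => eval_coefs x a%:P = (ffval a x)%:P).
Proof.
apply: generic_mono (generic_and (coef_eval_coefs a%:P) (ffval_cst 0)) => x [E E0].
by apply/polyP => i; rewrite E !coefC; case: eqP.
Qed.

Lemma eval_coefsZXn a j : generically (fun x =>
  eval_coefs x (a *: 'X^j) = ffval a x *: 'X^j).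
Proof.
apply: generic_mono (generic_and (coef_eval_coefs (a *: 'X^j)) (ffval_cst 0)).
move=> x [E E0]; apply/polyP => i; rewrite E !coefZ !coefXn.
by case: eqP; rewrite ?mulr1 ?mulr0.
Qed.

Lemma eval_coefs_map (p : {poly k}) : generically (fun x =>
  eval_coefs x (map_poly (ff_cst X) p) = p).
Proof.
have H := generic_forall (n := size p) (fun i _ => ffval_cst p`_i).
apply: generic_mono (generic_and H (coef_eval_coefs (map_poly (ff_cst X) p))).
move=> x [Hx E]; apply/polyP => i.
case: (ltnP i (size p)) => [lti|lei]; first by rewrite E coef_map_id0 // Hx.
by rewrite coef_poly ltnNge (leq_trans (size_poly _ _)) //= nth_default.
Qed.

Lemma eval_coefs_neq0 p : p != 0 -> generically (fun x => eval_coefs x p != 0).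
Proof.
rewrite -lead_coef_eq0 => /ffval_neq0.
move=> /(generic_and (coef_eval_coefs p)); apply: generic_mono => x [E].
by rewrite lead_coefE -E; apply: contraNneq => ->; rewrite coef0.
Qed.

Lemma ff_cstM a b : ff_cst X (a * b) = ff_cst X a * ff_cst X b.
Proof. by rewrite [RHS]ff_mulE; apply: germ_eqT. Qed.

Lemma ff_cstX a n : ff_cst X (a ^+ n) = ff_cst X a ^+ n.
Proof. by elim: n => // n IH; rewrite !exprS ff_cstM IH. Qed.

Lemma ffval_horner p a :
  generically (fun x => ffval p.[ff_cst X a] x = (eval_coefs x p).[a]).
Proof.
rewrite horner_coef.
have H1 i : generically (fun x =>
    ffval (p`_i * ff_cst X a ^+ i) x = ffval p`_i x * a ^+ i).
  have := generic_and (ffvalM p`_i (ff_cst X a ^+ i)) (ffval_cst (a ^+ i)).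
  by apply: generic_mono => x [-> +]; rewrite ff_cstX => ->.
have := generic_and (ffval_sum (size p) (fun i => p`_i * ff_cst X a ^+ i))
  (generic_forall (n := size p) (fun i _ => H1 i)).
apply: generic_mono => x [-> H]; rewrite horner_poly.
by apply: eq_bigr => i _; rewrite H.
Qed.

Definition coef_dom (p : {poly K}) : set X :=
  [set x | forall i : 'I_(size p), gdom (repr p`_i) x].

Lemma coef_dom_open p : open (coef_dom p).
Proof. by apply: open_forall_ord => i; exact: gdom_open. Qed.

Lemma coef_dom_generic p : generically (coef_dom p).
Proof. by apply: generic_forall_ord => i; exact: ffval_dom. Qed.

Lemma poly_at_reg p : reg (setT `*` coef_dom p : set GX) (poly_at p).
Proof.
have oD : open (setT `*` coef_dom p : set GX).
  exact: open_setX openT (coef_dom_open p).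
pose F (i : 'I_(size p)) (z : GX) := gfun (repr p`_i) z.2 * sval z.1 ^+ i.
apply: (reg_sum _ (F := F)) => // i; apply: reg_mul => //.
  apply: reg_snd; [exact: openT|exact: coef_dom_open|].
  by apply: reg_sub (gfun_reg _) => [|x]; [exact: coef_dom_open|exact].
apply: reg_exp => //; apply: (reg_fst (a := fun t : Gm k => sval t)).
- exact: openT.
- exact: coef_dom_open.
- exact: reg_Gm_coord.
Qed.

Lemma generic_GX (P : X -> Prop) : generically P ->
  generically (fun z : GX => P z.2).
Proof.
have [x0 _] := variety_nonempty X.
exact: (generic_snd (Gm_irreducible char0) variety_irr (gm1 k : Gm k) x0).
Qed.

(** The nonvanishing locus is open, and it has a point: some x keeps p nonzero, and a nonzero
    polynomial over k has a nonroot in Gm. *)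
Lemma poly_at_neq0 p : p != 0 -> generically (fun z => poly_at p z != 0).
Proof.
move=> p0; have oD : open (setT `*` coef_dom p : set GX).
  exact: open_setX openT (coef_dom_open p).
apply: (irreducible_generic GX_irr (reg_neq0_open oD (@poly_at_reg p))); last first.
  by move=> z [].
have [x0 _] := variety_nonempty X.
have [|x [_ [px xD]]] := generic_meet (generic_and (eval_coefs_neq0 p0)
  (coef_dom_generic p)) openT; first by exists x0.
have [t pt] := Gm_nonroot char0 px.
by exists (t, x); split=> //=; rewrite poly_atE.
Qed.

Lemma poly_atD p q : generically (fun z =>
  poly_at (p + q) z = poly_at p z + poly_at q z).
Proof.
apply: generic_mono (generic_GX (eval_coefsD p q)) => -[t x] /= E.
by rewrite !poly_atE E hornerD.
Qed.

Lemma poly_atM p q : generically (fun z =>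
  poly_at (p * q) z = poly_at p z * poly_at q z).
Proof.
apply: generic_mono (generic_GX (eval_coefsM p q)) => -[t x] /= E.
by rewrite !poly_atE E hornerM.
Qed.

Lemma frac_at_div p q : q != 0 -> generically (fun z =>
  poly_at q z != 0 /\
  frac_at (tofrac p / tofrac q) z = poly_at p z / poly_at q z).
Proof.
move=> q0; rewrite /frac_at; set r := repr _.
have d0 : \d_r != 0 by exact: denom_ratioP.
have /eqP := divf_num_den (tofrac p / tofrac q); rewrite -/r.
move: \n_r d0 => n; move: \d_r => d d0.
rewrite tofrac_div_eq // => /eqP E.
have := generic_and (generic_and (poly_at_neq0 q0) (poly_at_neq0 d0))
  (generic_and (poly_atM n q) (poly_atM p d)).
apply: generic_mono => z [[qz dz] [E1 E2]]; split=> //.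
by apply/eqP; rewrite eqr_div // -E1 -E2 E.
Qed.

Lemma fracP (r : Kt) : exists p q, q != 0 /\ r = tofrac p / tofrac q.
Proof.
exists \n_(repr r), \d_(repr r); split; first exact: denom_ratioP.
by rewrite divf_num_den.
Qed.

Lemma frac_atD (r s : Kt) : generically (fun z =>
  frac_at (r + s) z = frac_at r z + frac_at s z).
Proof.
have [p [q [q0 ->]]] := fracP r; have [p' [q' [q'0 ->]]] := fracP s.
rewrite tofrac_addf //.
have := generic_and (frac_at_div (p * q' + p' * q) (mulf_neq0 q0 q'0))
 (generic_and (generic_and (frac_at_div p q0) (frac_at_div p' q'0))
  (generic_and (poly_atD (p * q') (p' * q))
   (generic_and (poly_atM p q') (generic_and (poly_atM p' q) (poly_atM q q'))))).
apply: generic_mono => z [[_ ->] [[[q0z ->] [q'0z ->]] [-> [-> [-> ->]]]]].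
by rewrite addf_div.
Qed.

Lemma frac_atM (r s : Kt) : generically (fun z =>
  frac_at (r * s) z = frac_at r z * frac_at s z).
Proof.
have [p [q [q0 ->]]] := fracP r; have [p' [q' [q'0 ->]]] := fracP s.
rewrite tofrac_mulf //.
have := generic_and (frac_at_div (p * p') (mulf_neq0 q0 q'0))
 (generic_and (generic_and (frac_at_div p q0) (frac_at_div p' q'0))
  (generic_and (poly_atM p p') (poly_atM q q'))).
apply: generic_mono => z [[_ ->] [[[q0z ->] [q'0z ->]] [-> ->]]].
by rewrite mulf_div.
Qed.

Lemma frac_at_tofrac p : generically (fun z =>
  frac_at (tofrac p) z = poly_at p z).
Proof.
have := generic_and (frac_at_div p (oner_neq0 _)) (generic_GX
  (generic_and (eval_coefsC 1) (ffval_cst 1))).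
apply: generic_mono => -[t x] [[_ E] [/= B E1]].
have p1 : poly_at (1 : {poly K}) ((t, x) : GX) = 1.
  by rewrite poly_atE -polyC1 B -ff_cst1 E1 hornerC.
by move: E; rewrite tofrac1 divr1 p1 divr1.
Qed.

Lemma frac_at_neq0 (r : Kt) : r != 0 -> generically (fun z => frac_at r z != 0).
Proof.
have [p [q [q0 ->]]] := fracP r => pq0.
have p0 : p != 0 by apply: contraNneq pq0 => ->; rewrite tofrac0 mul0r.
apply: generic_mono (generic_and (frac_at_div p q0) (poly_at_neq0 p0)).
by move=> z [[qz ->] pz]; rewrite mulf_neq0 ?invr_eq0.
Qed.

Lemma frac_at_inj (r s : Kt) :
  generically (fun z => frac_at r z = frac_at s z) -> r = s.
Proof.
move=> H; apply/eqP; rewrite -subr_eq0; apply: contrapT => /negP rs.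
have := generic_and H (generic_and (frac_at_neq0 rs) (frac_atD (r - s) s)).
have [x0 _] := variety_nonempty X.
move=> /generic_meet/(_ openT)[|z [_ [E [n0]]]]; first by exists (gm1 k, x0).
by rewrite subrK E => /eqP; rewrite -subr_eq subrr eq_sym; exact/negP.
Qed.

Lemma frac_at_sum (n : nat) (F : nat -> Kt) : generically (fun z =>
  frac_at (\sum_(i < n) F i) z = \sum_(i < n) frac_at (F i) z).
Proof.
elim: n => [|n IH].
  (* The value v of the zero polynomial satisfies v = v + v. *)
  have := generic_and (frac_at_tofrac 0) (poly_atD 0 0).
  apply: generic_mono => z [+ /eqP]; rewrite addr0 -subr_eq subrr tofrac0.
  by move=> + /eqP E; rewrite !big_ord0 -E.
apply: generic_mono (generic_and (frac_atD (\sum_(i < n) F i) (F n)) IH).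
by move=> z [E1 E2]; rewrite !big_ord_recr /= E1 E2.
Qed.

End Values.

(** * Regular functions on Gm * X *)

Section RegularRational.
Variables (k : closedFieldType) (X : variety k).
Hypothesis char0 : [pchar k] =i pred0.
Local Notation K := (funfield X).
Local Notation Kt := {fraction {poly K}}.
Local Notation Gm := (Gm k).
Local Notation GX := (zprod Gm X).
Implicit Types (p q : {poly K}) (z : GX).

(** Only the set of t is shrunk: functions on Gm are locally fractions of k[t], whereas a regular
    function on V is a single element of K_X. The order of quantifiers, generic x and then all t in
    U', permits evaluation at t0. *)
Lemma tensor_rational (U : set Gm) (V : set X) (f : GX -> k) t0 x0 :
  open U -> open V -> U t0 -> V x0 -> tensor U V f ->
  exists (U' : set Gm) (p : {poly k}) (P : {poly K}),
    [/\ open U', U' t0, forall t, U' t -> p.[sval t] != 0 &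
    generically (fun x : X => forall t, U' t -> V x ->
      f (t, x) = (eval_coefs x P).[sval t] / p.[sval t])].
Proof.
move=> oU oV Ut Vx; elim=> [a ra|b rb|g h _ IHg _ IHh|g h _ IHg _ IHh].
- have [U' [p [q [oU' U't _ H]]]] := reg_Gm_local ra Ut.
  exists U', q, (map_poly (ff_cst X) p); split=> // [t /H[]//|].
  by apply: generic_mono (eval_coefs_map X p) => x -> t /H[].
- have dV : dense V by apply: open_dense => //; exists x0.
  exists setT, 1, (\pi_(funfield X)%qT (Germ oV dV rb))%:P; split=> //.
  + exact: openT.
  + by move=> t _; rewrite hornerC oner_neq0.
  + have := generic_and (eval_coefsC (\pi_(funfield X)%qT (Germ oV dV rb)))
      (ffval_cls (Germ oV dV rb)).
    by apply: generic_mono => x [-> [_ _ E]] t _ _; rewrite !hornerC divr1 E.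
- have [U1 [p1 [P1 [oU1 U1t p1U H1]]]] := IHg.
  have [U2 [p2 [P2 [oU2 U2t p2U H2]]]] := IHh.
  exists (U1 `&` U2), (p1 * p2),
    (P1 * map_poly (ff_cst X) p2 + P2 * map_poly (ff_cst X) p1); split=> //.
  + exact: openI.
  + by move=> t [/p1U ? /p2U ?]; rewrite hornerM mulf_neq0.
  + have := generic_and (generic_and H1 H2) (generic_and
     (generic_and (eval_coefs_map X p1) (eval_coefs_map X p2))
     (generic_and (eval_coefsD (P1 * map_poly (ff_cst X) p2)
                               (P2 * map_poly (ff_cst X) p1))
     (generic_and (eval_coefsM P1 (map_poly (ff_cst X) p2))
                  (eval_coefsM P2 (map_poly (ff_cst X) p1))))).
    apply: generic_mono => x [[{}H1 {}H2] [[E1 E2] [-> [-> ->]]]] t [U1t' U2t'] Vx'.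
    by rewrite H1 // H2 // E1 E2 hornerD !hornerM addf_div ?p1U ?p2U.
- have [U1 [p1 [P1 [oU1 U1t p1U H1]]]] := IHg.
  have [U2 [p2 [P2 [oU2 U2t p2U H2]]]] := IHh.
  exists (U1 `&` U2), (p1 * p2), (P1 * P2); split=> //.
  + exact: openI.
  + by move=> t [/p1U ? /p2U ?]; rewrite hornerM mulf_neq0.
  + apply: generic_mono (generic_and (generic_and H1 H2) (eval_coefsM P1 P2)).
    move=> x [[{}H1 {}H2] ->] t [U1t' U2t'] Vx'.
    by rewrite H1 // H2 // !hornerM mulf_div.
Qed.

Lemma regular_rational (N : set GX) (h : GX -> k) t0 x0 : reg N h -> N (t0, x0) ->
  exists (O : set GX) (P Q : {poly K}), [/\ open O, O (t0, x0), O `<=` N &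
    generically (fun x : X => forall t, O (t, x) ->
      (eval_coefs x Q).[sval t] != 0 /\
      h (t, x) = (eval_coefs x P).[sval t] / (eval_coefs x Q).[sval t])].
Proof.
move=> rh /rh[O [D [D' [g [g' [oO Oz ON [BD BD'] H]]]]]].
have [U1 [V1 [oU1 oV1 DE t1]]] := BD; have [U2 [V2 [oU2 oV2 D'E t2]]] := BD'.
subst D D'.
have [[/= U1t V1x] [/= U2t V2x] _ _] := H _ Oz.
have [U1' [p1 [P1 [oU1' U1t' p1U H1]]]] := tensor_rational oU1 oV1 U1t V1x t1.
have [U2' [p2 [P2 [oU2' U2t' p2U H2]]]] := tensor_rational oU2 oV2 U2t V2x t2.
exists (O `&` ((U1' `&` U2') `*` setT)), (P1 * map_poly (ff_cst X) p2),
  (P2 * map_poly (ff_cst X) p1); split.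
- by apply: openI => //; exact: open_setX (openI oU1' oU2') openT.
- by [].
- by move=> z [/ON].
- have := generic_and (generic_and H1 H2) (generic_and
     (generic_and (eval_coefs_map X p1) (eval_coefs_map X p2))
     (generic_and (eval_coefsM P1 (map_poly (ff_cst X) p2))
                  (eval_coefsM P2 (map_poly (ff_cst X) p1)))).
  apply: generic_mono => x [[{}H1 {}H2] [[E1 E2] [-> ->]]] t.
  move=> [Ot [[/= U1s U2s] _]]; have [[/= _ V1s] [/= _ V2s] n0 ->] := H _ Ot.
  rewrite !hornerM E1 E2 H1 // H2 //.
  have p1t := p1U _ U1s; have p2t := p2U _ U2s.
  have P2t : (eval_coefs x P2).[sval t] != 0.
    by move: n0; rewrite H2 // mulf_eq0 negb_or => /andP[].
  by rewrite mulf_neq0 // invf_div mulf_div [p1.[_] * _]mulrC.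
Qed.

End RegularRational.

(** * Semi-invariant coefficients of reduced fractions *)

Lemma coef_comp_scaleX (R : comNzRingType) (p : {poly R}) (T : R) j :
  (p \Po (T *: 'X))`_j = p`_j * T ^+ j.
Proof.
have -> : p \Po (T *: 'X) = \poly_(i < size p) (p`_i * T ^+ i).
  rewrite comp_polyE poly_def; apply: eq_bigr => i _.
  by rewrite exprZn scalerA.
rewrite coef_poly; case: ltnP => // /(nth_default 0)->.
by rewrite mul0r.
Qed.

Section SemiInvariants.
Variables (K L : fieldType) (c iota : {rmorphism K -> L}) (T : L).
Hypothesis T0 : T != 0.

(* [P / Q] has two reduced forms with respect to the coaction: both numerators
   and denominators are then proportional, and comparing the leading
   coefficients gives the ratio. *)
Lemma semi_invariant_coefs (P Q : {poly K}) : coprimep P Q -> Q \is monic ->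
  (forall i, \sum_(j < i.+1) c P`_j * (iota Q`_(i - j) * T ^+ (i - j))
     = \sum_(j < i.+1) c Q`_j * (iota P`_(i - j) * T ^+ (i - j))) ->
  forall j, c P`_j = iota P`_j * T ^+ j / T ^+ (size Q).-1
         /\ c Q`_j = iota Q`_j * T ^+ j / T ^+ (size Q).-1.
Proof.
move=> cop monQ Ecoef.
have E : map_poly c P * (map_poly iota Q \Po (T *: 'X))
    = map_poly c Q * (map_poly iota P \Po (T *: 'X)).
  apply/polyP => i; rewrite !coefM.
  have F (A B : {poly K}) : \sum_(j < i.+1) (map_poly c A)`_j
        * (map_poly iota B \Po (T *: 'X))`_(i - j)
      = \sum_(j < i.+1) c A`_j * (iota B`_(i - j) * T ^+ (i - j)).
    by apply: eq_bigr => j _; rewrite coef_comp_scaleX !coef_map.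
  by rewrite !F.
have sT : size (T *: 'X) = 2 by rewrite size_scale // size_polyX.
have coefT (R : {poly K}) j :
    (map_poly iota R \Po (T *: 'X))`_j = iota R`_j * T ^+ j.
  by rewrite coef_comp_scaleX coef_map.
have sizeT (R : {poly K}) : size (map_poly iota R \Po (T *: 'X)) = size R.
  by rewrite size_comp_poly2 // size_map_poly.
set Qt := map_poly iota Q \Po _ in E *; set Pt := map_poly iota P \Po _ in E *.
have copt : coprimep Qt Pt.
  by rewrite coprimep_comp_poly // coprimep_map coprimep_sym.
(* Qt divides c(Q) Pt and is coprime to Pt, so it divides c(Q), which has the same size. *)
have /dvdp_size_eqp : Qt %| map_poly c Q.
  by rewrite -(Gauss_dvdpl _ copt) -E dvdp_mull.
rewrite sizeT size_map_poly eqxx => /esym/eqp_eq.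
rewrite lead_coef_map (monicP monQ) rmorph1 scale1r lead_coefE sizeT coefT.
rewrite -lead_coefE (monicP monQ) rmorph1 mul1r; set m := (size Q).-1.
move=> EQ; have Tm : T ^+ m != 0 by rewrite expf_neq0.
have EP : Pt = T ^+ m *: map_poly c P.
  have Q0 : map_poly c Q != 0 by rewrite map_poly_eq0 monic_neq0.
  by apply: (mulfI Q0); rewrite -E EQ -!scalerAr [in RHS]mulrC.
move=> j; rewrite -!coefT -/Pt -/Qt EQ EP !coefZ !coef_map.
by rewrite ![_ * _ / _]mulrAC !divff // !mul1r.
Qed.

End SemiInvariants.

(** * The coaction of a rational action *)

Lemma reduced_fraction (K : fieldType) (P0 Q0 : {poly K}) : Q0.[1] != 0 ->
  exists P Q, [/\ coprimep P Q, Q \is monic, Q.[1] != 0 & P0 * Q = P * Q0].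
Proof.
move=> Q01; have Q0n := horner1_neq0 Q01; set g := gcdp P0 Q0.
have gP : P0 %/ g * g = P0 by apply: divpK; exact: dvdp_gcdl.
have gQ : Q0 %/ g * g = Q0 by apply: divpK; exact: dvdp_gcdr.
set P1 := P0 %/ g in gP; set Q1 := Q0 %/ g in gQ.
have Q1n : Q1 != 0 by apply: contraNneq Q0n => E; rewrite -gQ E mul0r.
have l0 : (lead_coef Q1)^-1 != 0 by rewrite invr_eq0 lead_coef_eq0.
exists ((lead_coef Q1)^-1 *: P1), ((lead_coef Q1)^-1 *: Q1); split.
- by rewrite coprimepZl // coprimepZr // coprimep_div_gcd // Q0n orbT.
- by rewrite monicE lead_coefZ mulVf ?lead_coef_eq0.
- rewrite hornerZ mulf_neq0 //.
  by apply: contraNneq Q01 => E; rewrite -gQ hornerM E mul0r.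
- by rewrite -{1}gP -gQ -scalerAr -scalerAl -!mulrA [g * _]mulrC.
Qed.

Section FromAction.
Variables (k : closedFieldType) (X : variety k).
Hypothesis char0 : [pchar k] =i pred0.
Local Notation K := (funfield X).
Local Notation Kt := {fraction {poly K}}.
Local Notation Gm := (Gm k).
Local Notation GX := (zprod Gm X).
Let GXirr := GX_irr (X := X) char0.
Let Girr := Gm_irreducible char0.

Variable p : Defs.pmap GX X.
Hypothesis p_assoc : exists W : set (zprod Gm GX), [/\ open W, dense W &
  forall (s t : Gm) (x : X), W (s, (t, x)) ->
    [/\ pdom p (t, x), pdom p (s, p (t, x)), pdom p (gm_mul s t, x) &
        p (s, p (t, x)) = p (gm_mul s t, x)]].
Hypothesis p_unit : exists U : set X, [/\ open U, dense U &
  forall x, U x -> pdom p (gm1 k, x) /\ p (gm1 k, x) = x].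

Lemma action_unit : generically (fun x => pdom p (gm1 k, x) /\ p (gm1 k, x) = x).
Proof. exact: p_unit. Qed.

(** Generic identities on X thus become generic identities on Gm * X by composition with [p]. *)
Lemma action_dominant (P : X -> Prop) : generically P ->
  generically (fun z => pdom p z /\ P (p z)).
Proof.
move=> [W [oW dW WP]]; have [oN _] := pfun_morph p oW.
apply: (irreducible_generic GXirr oN); last by move=> z [? /WP].
have [x0 _] := variety_nonempty X; have [x1 [_ Wx1]] := dW setT (ex_intro _ x0 I) openT.
have [|x [Wx [px pE]]] := generic_meet action_unit oW; first by exists x1.
by exists (gm1 k, x); split=> //=; rewrite pE.
Qed.

Lemma action_pullback (f : K) : exists r : Kt,
  generically (fun z => frac_at r z = ffval f (p z)) /\
  exists P Q : {poly K}, [/\ Q.[1] != 0, f * Q.[1] = P.[1]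
    & r = tofrac P / tofrac Q].
Proof.
pose N := pdom p `&` p @^-1` gdom (repr f).
have [_ /(_ _ (gfun_reg (repr f))) rN] := pfun_morph p (gdom_open (repr f)).
have [x1 _] := variety_nonempty X.
have [|x0 [_ [[px0 pE0] fx0]]] := generic_meet
  (generic_and action_unit (ffval_dom f)) openT; first by exists x1.
have Nx0 : N (gm1 k, x0) by split=> //=; rewrite pE0.
(* The local formula is taken around (1, x0), so that it can be read at t = 1 for generic x. *)
have [O [P [Q [oO Ox0 ON H]]]] := regular_rational rN Nx0.
have oO1 : open [set x | O (gm1 k, x)] := open_slice_snd (gm1 k : Gm) oO.
have O1 : [set x | O (gm1 k, x)] !=set0 by exists x0.
have gO1 := irreducible_generic (@variety_irr _ X) oO1 O1 (fun x Ox => Ox).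
have ffval1 (R : {poly K}) :
    generically (fun x => ffval R.[1] x = (eval_coefs x R).[1]).
  exact: (ffval_horner R 1).
have Q1 : Q.[1] != 0.
  apply/eqP => Q10; have := generic_and (generic_and gO1 H)
    (generic_and (ffval1 Q) (ffval_cst X 0)).
  move=> /generic_meet/(_ openT)[|x [_ [[Ox /(_ _ Ox)[+ _]] [E E0]]]].
    by exists x1.
  by rewrite -E Q10 E0 eqxx.
exists (tofrac P / tofrac Q); split; last first.
  exists P, Q; split=> //; apply: ffval_inj.
  (* At t = 1 the formula reads f(x) = P(1)(x) / Q(1)(x), by the unit axiom. *)
  have := generic_and (generic_and (generic_and gO1 action_unit) H)
    (generic_and (ffvalM f Q.[1]) (generic_and (ffval1 Q) (ffval1 P))).
  apply: generic_mono => x [[[Ox [_ px]] /(_ _ Ox)[Qx + ]] [-> [-> ->]]].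
  by rewrite /= px /ffval => ->; rewrite mulfVK.
have gO : generically O.
  by apply: (irreducible_generic GXirr oO) => //; exists (gm1 k, x0).
have := generic_and (generic_and gO (generic_GX char0 H))
  (frac_at_div char0 P (horner1_neq0 Q1)).
apply: generic_mono => -[t x] [[Ot /(_ _ Ot)[_ E]] [_ ->]].
by rewrite !poly_atE -E.
Qed.

Definition pullback (f : K) : Kt := projT1 (cid (action_pullback f)).

Lemma frac_at_pullback f :
  generically (fun z => frac_at (pullback f) z = ffval f (p z)).
Proof. by rewrite /pullback; case: cid => r []. Qed.

Lemma pullbackP f : exists P Q : {poly K}, [/\ Q.[1] != 0, f * Q.[1] = P.[1]
  & pullback f = tofrac P / tofrac Q].
Proof. by rewrite /pullback; case: cid => r []. Qed.

Lemma pullbackD : {morph pullback : f g / f + g}.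
Proof.
move=> f g; apply: (frac_at_inj char0).
have := generic_and (action_dominant (ffvalD f g)) (generic_and
  (frac_at_pullback (f + g)) (generic_and (frac_at_pullback f)
  (generic_and (frac_at_pullback g) (frac_atD char0 (pullback f) (pullback g))))).
by apply: generic_mono => z [[_ E] [-> [E1 [E2 ->]]]]; rewrite E1 E2.
Qed.

Lemma pullbackM : {morph pullback : f g / f * g}.
Proof.
move=> f g; apply: (frac_at_inj char0).
have := generic_and (action_dominant (ffvalM f g)) (generic_and
  (frac_at_pullback (f * g)) (generic_and (frac_at_pullback f)
  (generic_and (frac_at_pullback g) (frac_atM char0 (pullback f) (pullback g))))).
by apply: generic_mono => z [[_ E] [-> [E1 [E2 ->]]]]; rewrite E1 E2.
Qed.

Lemma pullback_cst a : pullback (ff_cst X a) = tofrac (ff_cst X a)%:P.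
Proof.
apply: (frac_at_inj char0).
have := generic_and (action_dominant (ffval_cst X a)) (generic_and
  (frac_at_pullback (ff_cst X a)) (generic_and
  (frac_at_tofrac char0 (ff_cst X a)%:P) (generic_GX char0
  (generic_and (eval_coefsC (ff_cst X a)) (ffval_cst X a))))).
apply: generic_mono => -[t x] [[_ E] [-> [-> [E1 /= E2]]]].
by rewrite E poly_atE E1 hornerC E2.
Qed.

Lemma pullback_zmod : zmod_morphism pullback.
Proof.
move=> f g; apply: (addIr (pullback g)).
by rewrite -pullbackD !subrK.
Qed.

Lemma pullback_monoid : monoid_morphism pullback.
Proof.
split; last exact: pullbackM.
by rewrite -[1]/(ff_cst X 1) pullback_cst ff_cst1 polyC1 tofrac1.
Qed.

HB.instance Definition _ := GRing.isZmodMorphism.Build K Kt pullback pullback_zmod.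
HB.instance Definition _ := GRing.isMonoidMorphism.Build K Kt pullback pullback_monoid.

(* Evaluate [f (s * (t * x)) = f (st * x)]: both sides are values of [P / Q],
   at [(s, t x)] and at [(st, x)]. *)
Lemma pullback_assoc (P Q : {poly K}) f :
  Q != 0 -> pullback f = tofrac P / tofrac Q ->
  generically (fun z : GX =>
    eval_coefs (p z) P * (eval_coefs z.2 Q \Po (sval z.1 *: 'X))
    = eval_coefs (p z) Q * (eval_coefs z.2 P \Po (sval z.1 *: 'X))).
Proof.
move=> Q0 fE; have [x0 _] := variety_nonempty X.
have H1 : generically (fun z : GX => poly_at Q z != 0 /\
    ffval f (p z) = poly_at P z / poly_at Q z).
  apply: generic_mono (generic_and (frac_at_div char0 P Q0) (frac_at_pullback f)).
  by move=> z [[Qz E1] <-]; rewrite fE.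
(* Used twice: at the point t x, reached by dominance, and at x, with s replaced by st. *)
have H2 := generic_slice Girr (@variety_irr _ X) (gm1 k : Gm) x0 H1.
have H0 : generically (fun w : zprod Gm GX =>
    p (w.1, p w.2) = p (gm_mul w.1 w.2.1, w.2.2)).
  have [W [oW dW WP]] := p_assoc; exists W; split=> // -[s [t x]] /WP[]//.
have H3 := generic_slice Girr GXirr (gm1 k : Gm) ((gm1 k : Gm), x0) H0.
have := generic_and H3 (generic_and (action_dominant H2) (generic_GX char0 H2)).
apply: generic_mono => -[t x] [Hs [[_ Hy] Hx]].
apply: (Gm_generic_poly char0).
have := generic_and Hs (generic_and Hy (Gm_generic_translate char0 t Hx)).
apply: generic_mono => s [E [[Qy Ey] [Qx Ex]]].
rewrite !hornerM !horner_comp !hornerZ !hornerX /= [sval t * _]mulrC.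
rewrite !poly_atE in Qy Ey Qx Ex.
move: Ex; rewrite -E Ey => /eqP; rewrite eqr_div // => /eqP {}E.
by rewrite [RHS]mulrC; exact: E.
Qed.

(** This is the coefficient of s^i in [pullback_assoc]: c(P_j) takes at (t, x) the value of P_j at t
    x, and substituting st for the variable multiplies Q_(i-j) by t^(i-j). *)
Lemma pullback_coassoc (P Q : {poly K}) f :
  Q != 0 -> pullback f = tofrac P / tofrac Q ->
  forall i, \sum_(j < i.+1) pullback P`_j * (tofrac (Q`_(i - j))%:P * tofrac 'X ^+ (i - j))
    = \sum_(j < i.+1) pullback Q`_j * (tofrac (P`_(i - j))%:P * tofrac 'X ^+ (i - j)).
Proof.
move=> Q0 fE i; apply: (frac_at_inj char0).
pose term (A B : {poly K}) j : Kt := pullback A`_j * tofrac (B`_(i - j) *: 'X^(i - j)).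
have termE (A B : {poly K}) :
    \sum_(j < i.+1) pullback A`_j * (tofrac (B`_(i - j))%:P * tofrac 'X ^+ (i - j))
    = \sum_(j < i.+1) term A B j.
  by apply: eq_bigr => j _; rewrite /term -tofracXn -tofracM mul_polyC.
have frac_term (A B : {poly K}) : generically (fun z : GX =>
    frac_at (\sum_(j < i.+1) term A B j) z =
    (eval_coefs (p z) A * (eval_coefs z.2 B \Po (sval z.1 *: 'X)))`_i).
  have H1 j : generically (fun z : GX => frac_at (term A B j) z
      = ffval A`_j (p z) * (ffval B`_(i - j) z.2 * sval z.1 ^+ (i - j))).
    have := generic_and (frac_atM char0 (pullback A`_j)
        (tofrac (B`_(i - j) *: 'X^(i - j)))) (generic_and
      (frac_at_pullback A`_j) (generic_and
      (frac_at_tofrac char0 (B`_(i - j) *: 'X^(i - j)))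
      (generic_GX char0 (eval_coefsZXn B`_(i - j) (i - j))))).
    apply: generic_mono => -[t x] [-> [-> [-> /= E]]].
    by rewrite poly_atE E hornerZ hornerXn.
  have := generic_and (frac_at_sum char0 i.+1 (term A B)) (generic_and
    (generic_forall (n := i.+1) (fun j _ => H1 j)) (generic_and
    (action_dominant (coef_eval_coefs A)) (generic_GX char0 (coef_eval_coefs B)))).
  apply: generic_mono => z [-> [{}H1 [[_ EA] EB]]]; rewrite coefM.
  by apply: eq_bigr => j _; rewrite H1 // EA coef_comp_scaleX EB.
rewrite !termE; have := generic_and (pullback_assoc Q0 fE)
  (generic_and (frac_term P Q) (frac_term Q P)).
by apply: generic_mono => z [E [-> ->]]; rewrite E.
Qed.

Lemma pullback_coaction : coaction pullback.
Proof.
split; [exact: pullbackD|exact: pullbackM|exact: pullback_cst|move=> f].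
have [P0 [Q0 [Q01 f0 fE0]]] := pullbackP f.
have [P [Q [cop monQ Q1 E]]] := reduced_fraction P0 Q01.
have fE : pullback f = tofrac P / tofrac Q.
  by rewrite fE0; apply/eqP; rewrite tofrac_div_eq ?horner1_neq0 // E.
have T0 : tofrac 'X != 0 :> Kt by rewrite tofrac_eq0 polyX_eq0.
have H := semi_invariant_coefs (c := pullback) (iota := @tofrac _ \o polyC) T0 cop monQ
  (pullback_coassoc (horner1_neq0 Q1) fE).
exists (size Q).-1, P, Q; split=> //.
  apply: (mulIf Q01); rewrite mulrAC f0 -hornerM E.
  by rewrite hornerM.
by split=> j; have [HP HQ] := H j; rewrite ?HP ?HQ /= -!tofracXn -tofracM mul_polyC.
Qed.

Lemma pullback_comorphism : is_comorphism (\pi_(ratmap GX X)%qT p) pullback.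
Proof.
move=> p' /eqmodP/asboolP pp' g.
have gp : generically (fun z => pdom p' z /\ p' z = p z).
  have [W [oW dW sW HW]] := pp'; exists W; split=> // z Wz.
  by have [? _] := sW z Wz; rewrite HW.
have := generic_and gp (generic_and (action_dominant (ffval_cls g))
  (frac_at_pullback (\pi_(funfield X)%qT g))).
move=> [W [oW dW HW]]; exists W; split=> // z /HW [[dp' Ep] [[_ [gd _ E]] E']] //.
- by rewrite Ep.
- by rewrite E' E Ep.
Qed.

End FromAction.

Lemma action_coaction (k : closedFieldType) (char0 : [pchar k] =i pred0)
    (X : variety k) (phi : ratmap (zprod (Gm k) X) X) : rational_action phi ->
  exists c, coaction c /\ is_comorphism phi c.
Proof.
move=> [p [<- p_assoc p_unit]]; exists (pullback char0 p_unit); split.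
  exact: pullback_coaction.
exact: pullback_comorphism.
Qed.

(** * The rational action of a coaction *)

Lemma mpoly_alg_ind (R : comNzRingType) n (P : {mpoly R[n]} -> Prop) :
  (forall c, P c%:MP) -> (forall i, P 'X_i) ->
  (forall p q, P p -> P q -> P (p + q)) ->
  (forall p q, P p -> P q -> P (p * q)) -> forall p, P p.
Proof.
move=> PC PX PD PM p; have Pexp i e : P ('X_i ^+ e).
  by elim: e => [|e IH]; [rewrite expr0 -mpolyC1|rewrite exprS; exact: PM].
rewrite [p]mpolyE; apply: big_ind => [||m _]; [by rewrite -mpolyC0|exact: PD|].
rewrite -mul_mpolyC mpolyXE_id; apply: (PM _ _ (PC _)).
by apply: big_ind => //; rewrite -mpolyC1.
Qed.

Lemma sval_inj (T : Type) (P : T -> Prop) : injective (@sval T P).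
Proof.
move=> [u Pu] [v Pv] /= uv; subst v; congr exist; exact: Prop_irrelevance.
Qed.

Lemma generic_dense (T : topologicalType) (P : set T) : generically P -> dense P.
Proof.
move=> [W [oW dW WP]] O O0 oO; have [x [Ox Wx]] := dW O O0 oO.
by exists x; split=> //; exact: WP.
Qed.

(** * Morphisms to affine sets *)

Section AffineTarget.
Variables (k : fieldType) (n : nat) (S : set {mpoly k[n]}).
Local Notation A := (affine_set S).

Lemma reg_poly_fun (p : {mpoly k[n]}) : reg setT (fun v : A => p.@[sval v]).
Proof.
move=> v _; exists setT, setT, setT, (fun v => p.@[sval v]), (fun=> 1); split=> //.
- exact: openT.
- by split; [split=> //; exists p|exact: bas_cst].
- by move=> w _; split=> //; rewrite ?oner_neq0 ?divr1.
Qed.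

Lemma affine_open_nbhs (V : set A) v : open V -> V v ->
  exists q : {mpoly k[n]}, q.@[sval v] != 0 /\
    forall w : A, q.@[sval w] != 0 -> V w.
Proof.
rewrite openbE => /[apply] -[D [_ [[-> [q ->]] _ qv H]]].
by exists q; split=> // w; exact: H.
Qed.

Lemma reg_affine_local (V : set A) (g : A -> k) v : reg V g -> V v ->
  exists (V' : set A) (a b : {mpoly k[n]}), [/\ open V', V' v, V' `<=` V &
    forall w, V' w -> b.@[sval w] != 0 /\ g w = a.@[sval w] / b.@[sval w]].
Proof.
move=> rg /rg[V' [D [E [_ [_ [oV' V'v V'V [[_ [a ->]] [_ [b ->]]] H]]]]]].
by exists V', a, b; split=> // w /H[].
Qed.

Variable Y : fspace k.

Lemma reg_meval (W : set Y) (f : 'I_n -> Y -> k) (p : {mpoly k[n]}) : open W ->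
  (forall i, reg W (f i)) -> reg W (fun z => p.@[f^~ z]).
Proof.
move=> oW rf; elim/mpoly_alg_ind: p => [c|i|p q rp rq|p q rp rq].
- by apply: (reg_ext oW (reg_cst c oW)) => z _; rewrite mevalC.
- by apply: (reg_ext oW (rf i)) => z _; rewrite mevalXU.
- by apply: (reg_ext oW (reg_add oW rp rq)) => z _; rewrite mevalD.
- by apply: (reg_ext oW (reg_mul oW rp rq)) => z _; rewrite mevalM.
Qed.

Lemma morph_to_affine (W : set Y) (F : Y -> A) : open W ->
  (forall i, reg W (fun z => sval (F z) i)) -> morph_on W F.
Proof.
move=> oW rF; have rFp p := reg_meval p oW rF.
have oF (V : set A) : open V -> open (W `&` F @^-1` V).
  move=> oV; apply: open_local => z [Wz /(affine_open_nbhs oV)[q [qz qV]]].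
  exists (W `&` [set z' | q.@[sval (F z')] != 0]); split=> //.
    exact: reg_neq0_open (rFp q).
  by move=> z' [Wz' qz']; split=> //; exact: qV.
move=> V oV; split; first exact: oF.
move=> g rg; apply: reg_local; first exact: oF.
move=> z [Wz /(reg_affine_local rg)[V' [a [b [oV' V'z V'V H]]]]].
exists (W `&` F @^-1` V'), (fun z' => a.@[sval (F z')] / b.@[sval (F z')]).
split=> //; first exact: oF.
- by move=> z' [? /V'V].
- apply: reg_sub (reg_div oW (rFp a) (rFp b)); first exact: oF.
  by move=> z' [Wz' /H[]].
- by move=> z' [_ /H[]].
Qed.

Lemma morph_comp_setT (X : fspace k) (W : set Y) (F : Y -> A) (y : A -> X) :
  morph_on W F -> morph_on setT y -> morph_on W (y \o F).
Proof.
move=> mF my V oV; have [] := my V oV; rewrite setTI => oV' ry.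
have [oW rW] := mF _ oV'; split=> // g /ry; exact: rW.
Qed.

End AffineTarget.

(** * The action in an affine chart *)

Section Chart.
Variables (k : closedFieldType) (X : variety k).
Hypothesis char0 : [pchar k] =i pred0.
Local Notation K := (funfield X).
Local Notation Kt := {fraction {poly K}}.
Local Notation Gm := (Gm k).
Local Notation GX := (zprod Gm X).
Local Notation cls := (\pi_(funfield X)%qT).
Let GXirr := GX_irr (X := X) char0.

Variables (U0 : set X) (n : nat) (S : set {mpoly k[n]}).
Variables (x : X -> affine_set S) (y : affine_set S -> X) (u0 : X).
Hypotheses (oU0 : open U0) (U0u0 : U0 u0).
Hypotheses (mx : morph_on U0 x) (my : morph_on setT y).
Hypothesis yx : forall u, U0 u -> y (x u) = u.

Lemma chart_dense : dense U0.
Proof. by apply: open_dense => //; exists u0. Qed.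

Lemma chart_reg p : reg U0 (fun u => p.@[sval (x u)]).
Proof.
have [_ /(_ _ (reg_poly_fun (S := S) p))] := mx (@openT _).
by rewrite setIT.
Qed.

Definition coordfun (p : {mpoly k[n]}) : K :=
  cls (Germ oU0 chart_dense (chart_reg p)).

Lemma coordfunD p q : coordfun (p + q) = coordfun p + coordfun q.
Proof. by rewrite [RHS]ff_addE; apply: germ_eqT => u; rewrite /= mevalD. Qed.

Lemma coordfunM p q : coordfun (p * q) = coordfun p * coordfun q.
Proof. by rewrite [RHS]ff_mulE; apply: germ_eqT => u; rewrite /= mevalM. Qed.

Lemma coordfunC c : coordfun c%:MP = ff_cst X c.
Proof. by apply: germ_eqT => u; rewrite /= mevalC. Qed.

Lemma ffval_coordfun p : generically (fun u =>
  U0 u /\ ffval (coordfun p) u = p.@[sval (x u)]).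
Proof.
by apply: generic_mono (ffval_cls (Germ oU0 chart_dense (chart_reg p))) => u [].
Qed.

Lemma coordfun_eq0 p : coordfun p = 0 -> forall u, U0 u -> p.@[sval (x u)] = 0.
Proof.
move=> p0; apply: (reg_zero oU0 (chart_reg p)).
apply: generic_mono (generic_and (ffval_coordfun p) (ffval_cst X 0)).
by move=> u [[_ <-] E0] _; rewrite p0.
Qed.

(** A point of the chart is [y] of its coordinates, and [c] prescribes the generic values of
    these. *)
Lemma comorphism_inj (phi phi' : ratmap GX X) (c : K -> Kt) :
  is_comorphism phi c -> is_comorphism phi' c -> phi = phi'.
Proof.
move=> H H'; rewrite -[phi]reprK -[phi']reprK.
have {}H := H _ (reprK phi); have {}H' := H' _ (reprK phi').
apply/eqmodP/asboolP.
pose g i := Germ oU0 chart_dense (chart_reg 'X_i).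
have Hi i : generically (fun z => [/\ pdom (repr phi) z, pdom (repr phi') z,
    U0 (repr phi z), U0 (repr phi' z) &
    sval (x (repr phi z)) i = sval (x (repr phi' z)) i]).
  have [W [oW dW WD Wg WE]] := H (g i); have [W' [oW' dW' WD' Wg' WE']] := H' (g i).
  exists (W `&` W'); split; [exact: openI|exact: dense_setI|].
  move=> z [Wz Wz']; split; [exact: WD|exact: WD'|exact: Wg|exact: Wg'|].
  by have := etrans (WE z Wz) (esym (WE' z Wz')); rewrite /= !mevalXU.
(* Membership in the chart is obtained separately, since the condition over i is empty when n =
   0. *)
have H1 : generically (fun z => [/\ pdom (repr phi) z, pdom (repr phi') z,
    U0 (repr phi z) & U0 (repr phi' z)]).
  pose g1 := Germ oU0 chart_dense (chart_reg 0).
  have [W [oW dW WD Wg _]] := H g1; have [W' [oW' dW' WD' Wg' _]] := H' g1.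
  exists (W `&` W'); split; [exact: openI|exact: dense_setI|].
  by move=> z [Wz Wz']; split; [exact: WD|exact: WD'|exact: Wg|exact: Wg'].
have [W [oW dW HW]] := generic_and H1 (generic_forall_ord Hi).
exists W; split=> // z /HW[[d1 d2 U1 U2] E] //.
rewrite -(yx U1) -(yx U2); congr y.
apply: sval_inj; apply/funext => i; by case: (E i).
Qed.

Variable c : K -> Kt.
Hypothesis cco : coaction c.

Let cD : {morph c : f g / f + g}. Proof. by case: cco. Qed.
Let cM : {morph c : f g / f * g}. Proof. by case: cco. Qed.
Let cC a : c (ff_cst X a) = tofrac (ff_cst X a)%:P. Proof. by case: cco. Qed.
Let c0 : c 0 = 0.
Proof. by rewrite -ff_cst0 cC ff_cst0 polyC0 tofrac0. Qed.
Let c1 : c 1 = 1.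
Proof. by rewrite -ff_cst1 cC ff_cst1 polyC1 tofrac1. Qed.

Let c_neq0 f : f != 0 -> c f != 0.
Proof.
move=> f0; apply/eqP => cf0; have := c1.
by rewrite -(mulVf f0) cM cf0 mulr0 => /eqP; rewrite eq_sym oner_eq0.
Qed.

Let frac_at0 : generically (fun z : GX => frac_at (0 : Kt) z = 0).
Proof.
apply: generic_mono (frac_at_sum char0 0 (fun=> 0 : Kt)) => z.
by rewrite !big_ord0.
Qed.

Lemma frac_at_coordfun p : generically (fun z : GX =>
  frac_at (c (coordfun p)) z = p.@[fun i => frac_at (c (coordfun 'X_i)) z]).
Proof.
elim/mpoly_alg_ind: p => [a|i|p q Hp Hq|p q Hp Hq].
- have := generic_and (frac_at_tofrac char0 (ff_cst X a)%:P) (generic_GX char0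
    (generic_and (eval_coefsC (ff_cst X a)) (ffval_cst X a))).
  apply: generic_mono => -[t u] [+ [E1 /= E2]].
  by rewrite coordfunC cC mevalC => ->; rewrite poly_atE E1 hornerC.
- by apply: generic_all => z; rewrite mevalXU.
- apply: generic_mono (generic_and (generic_and Hp Hq)
    (frac_atD char0 (c (coordfun p)) (c (coordfun q)))).
  by move=> z [[E1 E2] E]; rewrite coordfunD cD E E1 E2 mevalD.
- apply: generic_mono (generic_and (generic_and Hp Hq)
    (frac_atM char0 (c (coordfun p)) (c (coordfun q)))).
  by move=> z [[E1 E2] E]; rewrite coordfunM cM E E1 E2 mevalM.
Qed.

Variables (m : 'I_n -> nat) (P Q : 'I_n -> {poly K}).
Hypotheses (Q1 : forall i, (Q i).[1] != 0)
  (coordE : forall i, coordfun 'X_i * (Q i).[1] = (P i).[1])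
  (ccoord : forall i, c (coordfun 'X_i) = tofrac (P i) / tofrac (Q i))
  (wP : forall i, weighted c (m i) (P i)) (wQ : forall i, weighted c (m i) (Q i)).

Definition quot_dom i : set GX := (setT `*` coef_dom (P i)) `&`
  ((setT `*` coef_dom (Q i)) `&` [set z | poly_at (Q i) z != 0]).
Definition act_dom : set GX := [set z | forall i, quot_dom i z].
Definition act_coord i (z : GX) : k := poly_at (P i) z / poly_at (Q i) z.

Lemma quot_dom_open i : open (quot_dom i).
Proof.
apply: openI; first exact: open_setX openT (coef_dom_open _).
apply: reg_neq0_open (@poly_at_reg _ _ _).
exact: open_setX openT (coef_dom_open _).
Qed.

Lemma act_dom_open : open act_dom.
Proof. exact: open_forall_ord quot_dom_open. Qed.

Lemma act_dom_generic : generically act_dom.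
Proof.
apply: generic_forall_ord => i.
have := generic_and (generic_GX char0 (generic_and (coef_dom_generic (P i))
  (coef_dom_generic (Q i)))) (poly_at_neq0 char0 (horner1_neq0 (Q1 i))).
by apply: generic_mono => z [[? ?] ?].
Qed.

Lemma act_coord_reg i : reg act_dom (act_coord i).
Proof.
apply: (reg_sub act_dom_open (U := quot_dom i)); first by move=> z /(_ i).
have oD : open ((setT `*` coef_dom (P i)) `&` (setT `*` coef_dom (Q i)) : set GX).
  by apply: openI; exact: open_setX openT (coef_dom_open _).
have rP : reg ((setT `*` coef_dom (P i)) `&` (setT `*` coef_dom (Q i)) : set GX)
    (poly_at (P i)).
  by apply: reg_sub (@poly_at_reg _ _ _) => // z [].
have rQ : reg ((setT `*` coef_dom (P i)) `&` (setT `*` coef_dom (Q i)) : set GX)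
    (poly_at (Q i)).
  by apply: reg_sub (@poly_at_reg _ _ _) => // z [].
by rewrite /quot_dom setIA; exact: reg_div.
Qed.

Lemma act_coord_frac : generically (fun z =>
  forall i, act_coord i z = frac_at (c (coordfun 'X_i)) z).
Proof.
apply: generic_forall_ord => i; rewrite ccoord.
by apply: generic_mono (frac_at_div char0 (P i) (horner1_neq0 (Q1 i))) => z [_ ->].
Qed.

Lemma act_coord_meval p : generically (fun z =>
  p.@[act_coord^~ z] = frac_at (c (coordfun p)) z).
Proof.
apply: generic_mono (generic_and act_coord_frac (frac_at_coordfun p)) => z [E ->].
by apply: meval_eq => i; rewrite E.
Qed.

(** The equations of the chart hold in K_X, hence generically for the images under c, hence on all
    of [act_dom] by regularity. *)
Lemma act_coord_zeros z : act_dom z -> forall p, S p -> p.@[act_coord^~ z] = 0.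
Proof.
move=> Wz p Sp; move: z Wz; apply: (reg_zero act_dom_open).
  exact: reg_meval act_dom_open act_coord_reg.
have p0 : coordfun p = 0.
  by apply: germ_eqT => u /=; exact: (svalP (x u)).
apply: generic_mono (generic_and (act_coord_meval p) frac_at0) => z [-> E] _.
by rewrite p0 c0.
Qed.

(** Outside [act_dom] the value [x u0] is a placeholder that makes the map total. *)
Definition act_point (z : GX) : affine_set S :=
  if pselect (act_dom z) is left Wz
  then exist _ (act_coord^~ z) (act_coord_zeros Wz) else x u0.

Lemma act_pointE z : act_dom z -> sval (act_point z) = act_coord^~ z.
Proof. by move=> Wz; rewrite /act_point; case: pselect. Qed.

Lemma act_morph : morph_on act_dom (y \o act_point).
Proof.
apply: morph_comp_setT my; apply: morph_to_affine => [|i]; first exact: act_dom_open.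
apply: reg_ext (act_coord_reg i) _; first exact: act_dom_open.
by move=> z Wz; rewrite act_pointE.
Qed.

Definition act_map : Defs.pmap GX X :=
  PMap act_dom_open (generic_dense act_dom_generic) act_morph.

Lemma act_comorphism : is_comorphism (\pi_(ratmap GX X)%qT act_map) c.
Proof.
move=> p' /eqmodP/asboolP pp' g.
have gp : generically (fun z => pdom p' z /\ p' z = act_map z /\ act_dom z).
  have [W [oW dW sW HW]] := pp'; exists W; split=> // z Wz.
  by have [? ?] := sW z Wz; rewrite HW.
(* Near a point of the chart where g is defined, g is a quotient a / b of polynomials in the
   coordinates. *)
have [u1 [Uu1 gu1]] : U0 `&` gdom g !=set0.
  by apply: gdom_dense => //; exists u0.
have [_ /(_ _ (gfun_reg g))] := my (gdom_open g); rewrite setTI => rgy.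
have [|V [a [b [oV Vx VG Vab]]]] := reg_affine_local (v := x u1) rgy.
  by rewrite /= yx.
(* The locus q != 0 is a neighbourhood of x(u1) inside V. As q is nonzero in K_X and c is injective,
   c(q) is nonzero, so the action generically lands there. *)
have [q [qx qV]] := affine_open_nbhs oV Vx.
have q0 : coordfun q != 0.
  by apply: contraNneq qx => q0; rewrite (coordfun_eq0 q0).
have gE : cls g * coordfun b = coordfun a.
  apply: ffval_inj; have := generic_and (generic_and (ffvalM (cls g) (coordfun b))
    (ffval_cls g)) (generic_and (generic_and (ffval_coordfun b) (ffval_coordfun a))
    (generic_and (ffval_coordfun q) (ffval_neq0 q0))).
  apply: generic_mono => u [[-> [_ _ ->]] [[[Uu ->] [_ ->]] [[_ ->] qu]]].
  have [bu] := Vab _ (qV (x u) qu); rewrite /= yx // => ->.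
  by rewrite mulfVK.
have := generic_and gp (generic_and (generic_and (act_coord_meval q)
   (frac_at_neq0 char0 (c_neq0 q0)))
  (generic_and (frac_atM char0 (c (cls g)) (c (coordfun b)))
  (generic_and (act_coord_meval a) (act_coord_meval b)))).
move=> [W [oW dW HW]].
have HWz z : W z -> [/\ pdom p' z, gdom g (p' z) & g (p' z) = frac_at (c (cls g)) z].
  move=> /HW[[dz [-> Az]] [[qz qz0] [+ [az bz]]]].
  rewrite -cM gE -az -bz -act_pointE // => E.
  have Vz : V (act_point z) by apply: qV; rewrite act_pointE // qz.
  have [bz0 Eg] := Vab _ Vz; split=> //; first exact: VG Vz.
  by rewrite /= [LHS]Eg E mulfK.
exists W; split=> // [z /HWz[]//|z /HWz[]//|z /HWz[]//].
Qed.

Lemma act_ffval (a : K) : generically (fun z =>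
  gdom (repr a) (act_map z) /\ ffval a (act_map z) = frac_at (c a) z).
Proof.
have [W [oW dW _ Wg WE]] := act_comorphism (erefl _) (repr a).
exists W; split=> // z Wz; split; first exact: Wg.
by have := WE z Wz; rewrite reprK.
Qed.

(** R_j(t u) = t^(j - l) R_j(u) for generic (t, u); summing against s^j covers every s at once. *)
Lemma act_weighted l (R : {poly K}) : weighted c l R -> generically (fun z : GX =>
  coef_dom R (act_map z) /\ forall s : Gm,
    poly_at R (s, act_map z) = poly_at R (gm_mul s z.1, z.2) / sval z.1 ^+ l).
Proof.
move=> wR.
have Hj j : generically (fun z : GX => gdom (repr R`_j) (act_map z) /\
    ffval R`_j (act_map z) = ffval R`_j z.2 * sval z.1 ^+ j / sval z.1 ^+ l).
  have Xl0 : 'X^l != 0 :> {poly K} by rewrite -size_poly_eq0 size_polyXn.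
  have := generic_and (act_ffval R`_j) (generic_and
    (frac_at_div char0 (R`_j *: 'X^j) Xl0) (generic_GX char0 (generic_and
      (eval_coefsZXn R`_j j) (generic_and (eval_coefsZXn 1 l) (ffval_cst X 1))))).
  apply: generic_mono => -[t u] [[Gz E0] [[_ F] [/= Ea [E1 Ec]]]]; split=> //.
  rewrite E0 wR F !poly_atE Ea -['X^l]scale1r E1 -ff_cst1 Ec.
  by rewrite scale1r hornerZ !hornerXn.
have := generic_forall (n := size R) (fun j _ => Hj j).
apply: generic_mono => -[t u] /= H; split=> [j|s]; first by have [] := H j (ltn_ord j).
rewrite /poly_at mulr_suml; apply: eq_bigr => j _.
have [_ E] := H j (ltn_ord j); rewrite /= -/(ffval _ _) E exprMn.
by rewrite -/(ffval _ u) mulrAC [sval s ^+ j * _]mulrC mulrA -!mulrA.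
Qed.

Lemma act_unit : exists U : set X, [/\ open U, dense U &
  forall u, U u -> pdom act_map (gm1 k, u) /\ act_map (gm1 k, u) = u].
Proof.
suff : generically (fun u => act_dom (gm1 k, u) /\ act_map (gm1 k, u) = u) by [].
have ffval1 (R : {poly K}) :
    generically (fun u => ffval R.[1] u = (eval_coefs u R).[1]).
  exact: (ffval_horner R 1).
have Hi i : generically (fun u => [/\ quot_dom i (gm1 k, u), U0 u &
    act_coord i (gm1 k, u) = sval (x u) i]).
  have := generic_and (generic_and (coef_dom_generic (P i)) (coef_dom_generic (Q i)))
   (generic_and (generic_and (ffval1 (P i)) (ffval1 (Q i)))
   (generic_and (ffval_neq0 (Q1 i)) (generic_and (ffval_coordfun 'X_i)
     (ffvalM (coordfun 'X_i) (Q i).[1])))).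
  apply: generic_mono => u [[dP dQ] [[EP EQ] [Qu [[Uu +] +]]]].
  rewrite coordE EP mevalXU => -> E; rewrite EQ in Qu E.
  split=> //; first by split=> //; split=> //=; rewrite poly_atE.
  by rewrite /act_coord !poly_atE /= [X in X / _]E mulfK.
(* The zero polynomial records that u lies in the chart even if n = 0. *)
have := generic_and (generic_forall_ord Hi) (ffval_coordfun 0).
apply: generic_mono => u [H [Uu _]].
have Au : act_dom (gm1 k, u) by move=> i; case: (H i).
split=> //=; rewrite -[RHS](yx Uu); congr y.
apply: sval_inj; rewrite act_pointE //; apply/funext => i; by case: (H i).
Qed.

Lemma act_assoc : exists W : set (zprod Gm GX), [/\ open W, dense W &
  forall (s t : Gm) (u : X), W (s, (t, u)) ->
    [/\ pdom act_map (t, u), pdom act_map (s, act_map (t, u)),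
        pdom act_map (gm_mul s t, u) &
        act_map (s, act_map (t, u)) = act_map (gm_mul s t, u)]].
Proof.
have [Z [oZ dZ HZ]] := generic_and act_dom_generic (generic_and
  (generic_forall_ord (fun i => act_weighted (@wP i)))
  (generic_forall_ord (fun i => act_weighted (@wQ i)))).
(* Q_i(st, u) is, up to a power of t, the denominator at (s, t u); its nonvanishing controls both
   (st, u) and (s, t u). *)
pose H i (w : zprod Gm GX) := poly_at (Q i) (gm_mul w.1 w.2.1, w.2.2).
have oZ' : open (setT `*` Z : set (zprod Gm GX)) by exact: open_setX openT oZ.
have rH i : reg (setT `*` Z : set (zprod Gm GX)) (H i).
  apply: (reg_sum _ (F := fun (j : 'I_(size (Q i))) (w : zprod Gm GX) =>
    ffval (Q i)`_j w.2.2 * (sval w.1 * sval w.2.1) ^+ j)) => // j.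
  apply: reg_mul => //; last first.
    apply: reg_exp => //; apply: reg_mul => //.
      apply: (reg_fst (a := fun s : Gm => sval s)) => //; first exact: openT.
      exact: reg_Gm_coord.
    apply: (reg_snd (b := fun z : GX => sval z.1)) => //; first exact: openT.
    apply: (reg_sub (U := setT `*` setT : set GX)) => //.
    apply: (reg_fst (a := fun s : Gm => sval s)); [exact: openT|exact: openT|].
    exact: reg_Gm_coord.
  apply: (reg_snd (b := fun z : GX => ffval (Q i)`_j z.2)) => //; first exact: openT.
  apply: (reg_sub (U := setT `*` gdom (repr (Q i)`_j) : set GX)) => //.
    move=> z /HZ[/(_ i)[_ [[_ dQ] _]] _]; split=> //; exact: dQ.
  apply: (reg_snd (b := ffval (Q i)`_j)); [exact: openT|exact: gdom_open|].
  exact: gfun_reg.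
pose W := (setT `*` Z : set (zprod Gm GX)) `&`
  [set w | forall i, ((setT `*` Z) `&` [set w | H i w != 0]) w].
have oW : open W.
  apply: openI => //; apply: open_forall_ord => i; exact: reg_neq0_open.
exists W; split=> //.
  apply: generic_dense; have irr := zprod_irreducible (Gm_irreducible char0) GXirr.
  apply: (irreducible_generic irr oW) => //.
  have [z [_ Zz]] := dZ setT (ex_intro _ (gm1 k, u0) I) openT.
  (* For s = 1 the condition is that Q_i be nonzero at z, which holds on Z. *)
  exists (gm1 k, z); split=> // i; split=> //=.
  have [/(_ i)[_ [_ Qz]] _] := HZ z Zz.
  by move: Qz; rewrite /H /poly_at /= mul1r.
move=> s t u [[_ /= /HZ[Az [HP HQ]]] Hw].
have t0 : sval t != 0 := svalP t.
have dst : act_dom (gm_mul s t, u).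
  move=> i; have [[_ dP] [[_ dQ] _]] := Az i.
  by split=> //; split=> //; have [_] := Hw i.
have dsz : act_dom (s, act_map (t, u)).
  move=> i; have [dP _] := HP i; have [dQ E] := HQ i.
  split=> //; split=> //=; rewrite E mulf_neq0 ?invr_eq0 ?expf_neq0 //.
  by have [_] := Hw i.
split=> //; rewrite /act_map /=; congr y; apply: sval_inj.
rewrite !act_pointE //; apply/funext => i; rewrite /act_coord.
have [_ EP] := HP i; have [_ EQ] := HQ i.
rewrite [X in X / _]EP [X in _ / X]EQ /=.
(* P_i and Q_i share the exponent m_i, so the powers of t cancel. *)
by rewrite -mulf_div divff ?mulr1 // invr_eq0 expf_neq0.
Qed.

Lemma chart_action : exists phi : ratmap GX X,
  rational_action phi /\ is_comorphism phi c.
Proof.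
exists (\pi_(ratmap GX X)%qT act_map); split; last exact: act_comorphism.
by exists act_map; split=> //; [exact: act_assoc|exact: act_unit].
Qed.

End Chart.

(** * The correspondence *)

Local Close Scope classical_set_scope.

Section Correspondence.
Variables (k : closedFieldType) (X : variety k).
Hypothesis char0 : [pchar k] =i pred0.
Local Notation K := (funfield X).
Local Notation Kt := {fraction {poly K}}.
Local Notation GX := (zprod (Gm k) X).

Lemma variety_chart : exists (U : set X) (u0 : X), U u0 /\ affine_open U.
Proof.
have [x0 _] := variety_nonempty X; have [m [U [aU cU]]] := variety_cover X.
by have [i Uix] := cU x0; exists (U i), x0.
Qed.

Lemma coaction_action (c : K -> Kt) : coaction c ->
  exists phi : ratmap GX X, rational_action phi /\ is_comorphism phi c.
Proof.
move=> cco; have [U [u0 [Uu0 [oU [n [S [x [y [mx my Uy yx _]]]]]]]]] := variety_chart.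
pose f i := coordfun oU Uu0 mx 'X_i.
have H i : exists mPQ : nat * {poly K} * {poly K},
    [/\ mPQ.2.[1] != 0, f i * mPQ.2.[1] = mPQ.1.2.[1],
      c (f i) = tofrac mPQ.1.2 / tofrac mPQ.2 &
      weighted c mPQ.1.1 mPQ.1.2 /\ weighted c mPQ.1.1 mPQ.2].
  case: cco => _ _ _ /(_ (f i))[m [P [Q HPQ]]].
  by exists (m, P, Q).
have [mPQ {}H] := choice H.
apply: (@chart_action _ _ char0 _ _ _ x y u0 oU Uu0 mx my yx c cco
  (fun i => (mPQ i).1.1) (fun i => (mPQ i).1.2) (fun i => (mPQ i).2)) => i;
  by have [? ? ? []] := H i.
Qed.

Lemma ratmap_comorphism_inj (phi phi' : ratmap GX X) (c : K -> Kt) :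
  is_comorphism phi c -> is_comorphism phi' c -> phi = phi'.
Proof.
have [U [u0 [Uu0 [oU [n [S [x [y [mx my Uy yx _]]]]]]]]] := variety_chart.
exact: comorphism_inj oU Uu0 mx yx _ _ _.
Qed.

Lemma comorphism_uniq (phi : ratmap GX X) (c c' : K -> Kt) :
  is_comorphism phi c -> is_comorphism phi c' -> c = c'.
Proof.
move=> H H'; apply/funext => f; rewrite -[f]reprK; apply: (frac_at_inj char0).
have [W [oW dW _ _ E]] := H _ (reprK phi) (repr f).
have [W' [oW' dW' _ _ E']] := H' _ (reprK phi) (repr f).
exists (W `&` W')%classic; split; [exact: openI|exact: dense_setI|].
by move=> z [/E <- /E' <-].
Qed.

Lemma comorphismE (phi : ratmap GX X) (c : K -> Kt) :
  is_comorphism phi c -> comorphism phi = c.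
Proof.
move=> H; apply: xget_unique => // c' H'; exact: comorphism_uniq H' H.
Qed.

Lemma D_ofE (phi : ratmap GX X) (c : K -> Kt) : is_comorphism phi c ->
  D_of phi = fun f => ev1 (ddt (c f)).
Proof. by move=> /comorphismE cE; apply/funext => f; rewrite /D_of cE. Qed.

(** The coefficient of t - 1 in the expansion of c f is d f. *)
Lemma is_phi_D_of (d : K -> K) (phi : ratmap GX X) : derivation d ->
  is_phi d phi -> D_of phi = d.
Proof.
move=> [dD dM _] [c [/D_ofE-> H]]; apply/funext => f.
rewrite (ev1_ddt_expansion (H f)) phi_starE //.
by rewrite /= mul0r subr0 divr1.
Qed.

Lemma is_phi_inj (d : K -> K) (phi phi' : ratmap GX X) :
  is_phi d phi -> is_phi d phi' -> phi = phi'.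
Proof.
move=> [c [H E]] [c' [H' E']]; apply: (ratmap_comorphism_inj H).
suff -> : c = c' by [].
by apply/funext => f; exact: is_expansion_uniq (E f) (E' f).
Qed.

Lemma action_is_phi (phi : ratmap GX X) : rational_action phi ->
  [/\ rational_semisimple (D_of phi), is_phi (D_of phi) phi,
      is_comorphism phi (comorphism phi) &
      forall f, ord1_ge0 (comorphism phi f)].
Proof.
move=> /(action_coaction char0)[c [cco cphi]].
rewrite (D_ofE cphi) (comorphismE cphi); split=> //.
- exact: coaction_semisimple.
- exists c; split=> // f; exact: coaction_expansion.
- exact: coaction_ord1.
Qed.

Lemma semisimple_is_phi (d : K -> K) : rational_semisimple d ->
  exists phi : ratmap GX X, rational_action phi /\ is_phi d phi.
Proof.
move=> /(exp_coaction char0)[c [cco cE]].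
by have [phi [aphi cphi]] := coaction_action cco; exists phi; split=> //; exists c.
Qed.

End Correspondence.

Theorem theorem2p14 (k : closedFieldType) (hk : [pchar k] =i pred0)
    (X : variety k) :
  exists (Phi : {d : funfield X -> funfield X | rational_semisimple d} ->
                {phi : ratmap (zprod (Gm k) X) X | rational_action phi})
         (Psi : {phi : ratmap (zprod (Gm k) X) X | rational_action phi} ->
                {d : funfield X -> funfield X | rational_semisimple d}),
    [/\ forall d,
          [/\ forall f, exists r, is_expansion r (phi_star (sval d) f),
              is_phi (sval d) (sval (Phi d)) &
              forall phi, is_phi (sval d) phi -> phi = sval (Phi d)],
        forall phi,
          [/\ is_comorphism (sval phi) (comorphism (sval phi)),
              forall c, is_comorphism (sval phi) c -> c = comorphism (sval phi),
              forall f, ord1_ge0 (comorphism (sval phi) f) &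
              sval (Psi phi) = D_of (sval phi)],
        cancel Phi Psi &
        cancel Psi Phi].
Proof.
have ex_phi (d : {d : funfield X -> funfield X | rational_semisimple d}) :
    exists phi : {phi : ratmap (zprod (Gm k) X) X | rational_action phi},
      is_phi (sval d) (sval phi).
  have [phi [aphi dphi]] := semisimple_is_phi hk (svalP d).
  by exists (exist _ phi aphi).
(* The choice is forced by [is_phi_inj], which also yields [cancel Psi Phi]; [is_phi_D_of] yields
   [cancel Phi Psi]. *)
have [Phi PhiP] := choice ex_phi.
have D_semisimple (phi : {phi : ratmap (zprod (Gm k) X) X | rational_action phi}) :
    rational_semisimple (D_of (sval phi)).
  by have [] := action_is_phi hk (svalP phi).
exists Phi, (fun phi => exist _ (D_of (sval phi)) (D_semisimple phi)); split.
- move=> d; split=> // [f|phi dphi]; last exact: is_phi_inj dphi (PhiP d).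
  by have [c [_ cE]] := PhiP d; exists (c f).
- move=> phi; have [_ _ cphi ophi] := action_is_phi hk (svalP phi).
  by split=> // c cphi'; apply: (comorphism_uniq hk) cphi' cphi.
- move=> d; apply: sval_inj => /=; apply: (is_phi_D_of hk) (PhiP d).
  by case: (svalP d).
- move=> phi; apply: sval_inj; apply: is_phi_inj (PhiP _) _ => /=.
  by have [] := action_is_phi hk (svalP phi).
Qed.
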